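(* Let $\underline{\mathcal{M}}$ be any matroid on $\{1,\dots,n\}$ with matroid ideal $M\subseteq\mathbf{k}[x_1,\dots,x_n]$, and let $P$ be its lattice of flats ordered by reverse inclusion, with each atom $H$ of $P$ (a hyperplane of $\underline{\mathcal{M}}$) labeled by $m_x(H)=\prod_{i\notin H}x_i$. Then the complex $(\mathcal{C}(P),\partial)$ is a minimal $\mathbb{N}^n$-graded free $\mathbf{k}[\mathbf{x}]$-resolution of $M$.
   Context: The matroid ideal $M$ is generated by $m_x(F)=\prod_{i\notin F}x_i$ for all proper flats $F$. In $P$, $\hat0=\{1,\dots,n\}$ and $\hat1$ is the smallest flat (closure of $\emptyset$); $P$ is graded. For $F\ne\hat0$ put $m_F=\mathrm{lcm}\{m_x(H):H\text{ an atom},H\le_P F\}$ and $m_{\hat0}=1$. For $F\in P$, $\Delta(F)$ is the order complex of the open interval $(\hat0,F)$ in $P$, with $i$-simplices the chains $[F_0,\dots,F_i]$, $F>F_0>\dots>F_i>\hat0$; $C_i(\Delta(F))$ are $\mathbf{k}$-chains ($C_{-1}=\mathbf{k}$ spanned by the empty chain) with augmented boundary $\partial[F_0,\dots,F_i]=\sum_j(-1)^j[F_0,\dots,\widehat{F_j},\dots,F_i]$, $\partial[F_0]=\emptyset$, cycles $Z_i(\Delta(F))$. For $\mathrm{rk}F-\mathrm{rk}F'=1$, $\phi:Z_i(\Delta(F))\to Z_{i-1}(\Delta(F'))$ maps $[F_0,\dots,F_i]$ to $[F_1,\dots,F_i]$ if $F_0=F'$ and to $0$ otherwise; for atoms, the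 empty chain maps to $1\in\mathbf{k}$. $\mathcal{C}(P)=\bigoplus_{F\in P}Z_{\mathrm{rk}(F)-2}(\Delta(F))\otimes_\mathbf{k}\langle m_F\rangle$, the $F$-summand in homological degree $\mathrm{rk}(F)-1$ (the $\hat0$-summand being $\mathbf{k}[\mathbf{x}]$ in degree $-1$), with differential $\phi\otimes$(inclusion $\langle m_F\rangle\to\langle m_{F'}\rangle$), where $\langle m\rangle$ is the free rank-one module generated in degree $\deg m$. ''Minimal free resolution of $M$'': exact in degrees $\ge0$, image of degree $0$ in $\mathbf{k}[\mathbf{x}]$ equal to $M$, and minimal. *)

(* Defs.v *)
From HB Require Import structures.
From mathcomp Require Import all_boot all_order all_algebra.
From mathcomp Require Export mpoly.

Set Implicit Arguments.
Unset Strict Implicit.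
Unset Printing Implicit Defensive.

Import GRing.Theory.
Local Open Scope ring_scope.

(* An S-submodule of an ambient module, with a candidate N^n-grading:
   gm_homog a is the component of multidegree a. *)
Record gmodule (n : nat) (k : fieldType) := GModule {
  gm_ambient : lmodType {mpoly k[n]};
  gm_mem : gm_ambient -> Prop;
  gm_homog : 'X_{1..n} -> gm_ambient -> Prop
}.

Record is_graded (n : nat) (k : fieldType) (C : gmodule n k) : Prop := IsGraded {
  gr_mem0 : gm_mem (0 : gm_ambient C);
  gr_memP : forall (p : {mpoly k[n]}) (u v : gm_ambient C),
    gm_mem u -> gm_mem v -> gm_mem (p *: u + v);
  gr_homog_mem : forall a (u : gm_ambient C), gm_homog a u -> gm_mem u;
  gr_homog0 : forall a, gm_homog a (0 : gm_ambient C);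
  gr_homogP : forall a (c : k) (u v : gm_ambient C),
    gm_homog a u -> gm_homog a v -> gm_homog a (c%:MP *: u + v);
  gr_homogX : forall a b (u : gm_ambient C),
    gm_homog a u -> gm_homog (b + a)%MM ('X_[b] *: u);
  gr_sum : forall u : gm_ambient C, gm_mem u ->
    exists (s : seq 'X_{1..n}) (w : 'X_{1..n} -> gm_ambient C),
      (forall a, gm_homog a (w a)) /\ u = \sum_(a <- s) w a;
  gr_direct : forall (s : seq 'X_{1..n}) (w : 'X_{1..n} -> gm_ambient C),
    uniq s -> (forall a, gm_homog a (w a)) -> \sum_(a <- s) w a = 0 ->
    forall a, a \in s -> w a = 0
}.

(* A finite S-basis consisting of homogeneous elements. *)
Definition has_homog_basis (n : nat) (k : fieldType) (C : gmodule n k) : Prop :=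
  exists (r : nat) (b : 'I_r -> gm_ambient C) (e : 'I_r -> 'X_{1..n}),
    [/\ forall i, gm_homog (e i) (b i),
        forall u, gm_mem u ->
          exists p : 'I_r -> {mpoly k[n]}, u = \sum_i p i *: b i
      & forall p : 'I_r -> {mpoly k[n]},
          \sum_i p i *: b i = 0 -> forall i, p i = 0].

(* Membership in (x_1, ..., x_n) C. *)
Definition in_irrelevant (n : nat) (k : fieldType) (C : gmodule n k)
    (v : gm_ambient C) : Prop :=
  exists w : 'I_n -> gm_ambient C,
    (forall i, gm_mem (w i)) /\ v = \sum_i 'X_i *: w i.

(* ... -> C 1 -> C 0 -> S, exact at every C d, with the image of C 0 equal to
   the ideal I.  Minimality only concerns the maps C d.+1 -> C d, since the
   object resolved is I and not S / I. *)
Record minimal_graded_free_resolution (n : nat) (k : fieldType)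
    (C : nat -> gmodule n k)
    (dd : forall d, gm_ambient (C d.+1) -> gm_ambient (C d))
    (eps : gm_ambient (C 0%N) -> {mpoly k[n]})
    (I : {mpoly k[n]} -> Prop) : Prop := MinimalGradedFreeResolution {
  res_graded : forall d, is_graded (C d);
  res_free : forall d, has_homog_basis (C d);
  res_dd_mem : forall d (u : gm_ambient (C d.+1)), gm_mem u -> gm_mem (dd d u);
  res_dd_linear : forall d (p : {mpoly k[n]}) (u v : gm_ambient (C d.+1)),
    gm_mem u -> gm_mem v -> dd d (p *: u + v) = p *: dd d u + dd d v;
  res_dd_graded : forall d a (u : gm_ambient (C d.+1)),
    gm_homog a u -> gm_homog a (dd d u);
  res_eps_linear : forall (p : {mpoly k[n]}) (u v : gm_ambient (C 0%N)),
    gm_mem u -> gm_mem v -> eps (p *: u + v) = p * eps u + eps v;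
  res_eps_graded : forall a (u : gm_ambient (C 0%N)),
    gm_homog a u -> exists c : k, eps u = c%:MP * 'X_[a];
  res_complex : forall d (u : gm_ambient (C d.+2)),
    gm_mem u -> dd d (dd d.+1 u) = 0;
  res_complex0 : forall u : gm_ambient (C 1%N), gm_mem u -> eps (dd 0%N u) = 0;
  res_exact : forall d (u : gm_ambient (C d.+1)), gm_mem u -> dd d u = 0 ->
    exists v, gm_mem v /\ dd d.+1 v = u;
  res_exact0 : forall u : gm_ambient (C 0%N), gm_mem u -> eps u = 0 ->
    exists v, gm_mem v /\ dd 0%N v = u;
  res_image : forall f, I f <-> exists u, gm_mem u /\ eps u = f;
  res_minimal : forall d (u : gm_ambient (C d.+1)),
    gm_mem u -> in_irrelevant (dd d u)
}.

Record matroid (n : nat) := Matroid {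
  indep : {set {set 'I_n}};
  indep0 : set0 \in indep;
  indepS : forall A B : {set 'I_n}, B \in indep -> A \subset B -> A \in indep;
  indep_aug : forall A B : {set 'I_n}, A \in indep -> B \in indep ->
    (#|A| < #|B|)%N -> exists2 x, x \in B :\: A & x |: A \in indep
}.

Section Flats.
Variables (n : nat) (M : matroid n).
Implicit Types F G H : {set 'I_n}.

Definition mrank (A : {set 'I_n}) : nat :=
  \max_(I in indep M | I \subset A) #|I|.

Definition mclosure (A : {set 'I_n}) : {set 'I_n} :=
  [set x | mrank (x |: A) == mrank A].

Definition flat F : bool := mclosure F == F.

(* Strict order of P (reverse inclusion); its minimum 0^ is setT. *)
Definition ltPf F G : bool := G \proper F.

Definition atom H : bool :=
  [&& flat H, ltPf setT H &
      ~~ [exists G, [&& flat G, ltPf setT G & ltPf G H]]].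

Definition is_chain (K : {set {set 'I_n}}) : bool :=
  [forall F in K, forall G in K, [|| F == G, ltPf F G | ltPf G F]].

(* Rank of F in P: the length of a longest chain of flats
   0^ = G_0 < ... < G_r = F, counted as the number of elements below F. *)
Definition rkP F : nat :=
  \max_(K : {set {set 'I_n}} |
        is_chain K && [forall G in K, flat G && ltPf G F]) #|K|.

(* Exponent of m_x(F) = \prod_(i \notin F) x_i. *)
Definition mexp F : 'X_{1..n} := [multinom nat_of_bool (i \notin F) | i < n].

(* Exponent of the label m_F. *)
Definition mlabel F : 'X_{1..n} :=
  if F == setT then 0%MM
  else \big[@mlcm n/0%MM]_(H | atom H && ((H == F) || ltPf H F)) mexp H.

(* t = [F_0, ..., F_(d-1)] is a simplex of Delta(F). *)
Definition simplex F (d : nat) (t : d.-tuple {set 'I_n}) : bool :=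
  all (fun G => [&& flat G, ltPf setT G & ltPf G F]) t
  && sorted (fun G G' => ltPf G' G) t.

End Flats.

(* Simplices are d-tuples of sets, so they have dimension d - 1. *)

Definition face (T : Type) (d : nat) (j : 'I_d.+1) (t : d.+1.-tuple T) :
    d.-tuple T :=
  [tuple tnth t (lift j i) | i < d].

Definition boundary (n : nat) (k : fieldType) (d : nat)
    (z : {ffun d.+1.-tuple {set 'I_n} -> k}) : {ffun d.-tuple {set 'I_n} -> k} :=
  [ffun s => \sum_(t : d.+1.-tuple {set 'I_n})
               \sum_(j < d.+1 | face j t == s) (-1) ^+ j * z t].

Definition boundary_free (n : nat) (k : fieldType) (d : nat) :
    {ffun d.-tuple {set 'I_n} -> k} -> Prop :=
  match d with
  | 0 => fun=> True
  | d'.+1 => fun z => boundary z = 0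
  end.

(* Z_(d-1)(Delta(F)) *)
Definition is_cycle (n : nat) (k : fieldType) (M : matroid n) (F : {set 'I_n})
    (d : nat) (z : {ffun d.-tuple {set 'I_n} -> k}) : Prop :=
  (forall t, z t != 0 -> simplex M F t) /\ boundary_free z.

(* phi, sending [F_0, ..., F_d] to [F_1, ..., F_d] if F_0 = F' and to 0
   otherwise.  It is extended linearly with coefficients in any A: A = k gives
   phi, and A = k[x] gives phi tensored with the inclusion <m_F> -> <m_F'>. *)
Definition phi (n : nat) (A : zmodType) (F' : {set 'I_n}) (d : nat)
    (u : {ffun d.+1.-tuple {set 'I_n} -> A}) : {ffun d.-tuple {set 'I_n} -> A} :=
  [ffun s => \sum_(t : d.+1.-tuple {set 'I_n} |
                   (thead t == F') && (behead_tuple t == s)) u t].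

(* <m> as the principal ideal generated by 'X_[m]: it is free of rank one on a
   generator of degree m, and the maps <m_F> -> <m_F'> are inclusions in S. *)
Definition in_principal (n : nat) (k : fieldType) (m : 'X_{1..n})
    (f : {mpoly k[n]}) : Prop :=
  exists g : {mpoly k[n]}, f = g * 'X_[m].

(* Z_(d-1)(Delta(F)) (x)_k <m_F>, as the finite sums of elementary tensors
   z (x) f inside (chains) (x)_k S = {ffun d.-tuple _ -> S}; k being a field,
   nothing is identified by this embedding. *)
Definition in_summand (n : nat) (k : fieldType) (M : matroid n) (F : {set 'I_n})
    (d : nat) (u : {ffun d.-tuple {set 'I_n} -> {mpoly k[n]}^o}) : Prop :=
  exists (r : nat) (z : 'I_r -> {ffun d.-tuple {set 'I_n} -> k})
         (f : 'I_r -> {mpoly k[n]}),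
    [/\ forall i, is_cycle M F (z i),
        forall i, in_principal (mlabel M F) (f i)
      & forall t, u t = \sum_i (z i t)%:MP * f i].

Section Complex.
Variables (n : nat) (k : fieldType) (M : matroid n).

(* The summands of homological degree d are those of the flats of rank d + 1
   in P; the other coordinates are zero. *)
Definition in_degree (d : nat) (F : {set 'I_n}) : bool :=
  flat M F && (rkP M F == d.+1).

Definition CPambient (d : nat) : lmodType {mpoly k[n]} :=
  {ffun {set 'I_n} -> {ffun d.-tuple {set 'I_n} -> {mpoly k[n]}^o}}.

Definition CPmem (d : nat) (u : CPambient d) : Prop :=
  forall F : {set 'I_n}, if in_degree d F then in_summand M F (u F) else u F = 0.

Definition CPhomog (d : nat) (a : 'X_{1..n}) (u : CPambient d) : Prop :=
  CPmem u /\
  forall (F : {set 'I_n}) (t : d.-tuple {set 'I_n}),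
    exists c : k, u F t = c%:MP * 'X_[a].

Definition CP (d : nat) : gmodule n k := GModule (@CPmem d) (@CPhomog d).

Definition CPdiff (d : nat) (u : CPambient d.+1) : CPambient d :=
  [ffun F' => if in_degree d F'
              then \sum_(F | in_degree d.+1 F) phi F' (u F) else 0].

(* The differential from degree 0 to the summand S of 0^ in degree -1: the
   empty chain of each atom maps to 1. *)
Definition CPaug (u : CPambient 0) : {mpoly k[n]} :=
  \sum_(H | in_degree 0 H) u H [tuple].

Definition matroid_ideal (f : {mpoly k[n]}) : Prop :=
  exists c : {set 'I_n} -> {mpoly k[n]},
    f = \sum_(F | flat M F && (F != setT)) c F * 'X_[mexp F].

End Complex.

(* Main.v *)
(** In multidegree a the complex only involves the flats containing
    {i | a_i = 0}, that is, the flats above their closure G, and it becomes the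
    complex of k-vector spaces whose F-summand is the space of top-dimensional
    cycles of the open interval between F and the ground set.  A family of such
    cycles over the flats F of corank m that is killed by the differential is
    the same as a top-dimensional cycle z on the saturated flags of flats
    containing G, of coranks 1, ..., m; exactness means that z is a sum of
    cycles each of which only involves flats strictly containing one flat of
    corank m + 1.

    This is proved by induction on m and on the corank of G.  Choose e outside
    G.  For a hyperplane H not containing e, the part of z on flags through H is
    decomposed inside H by induction, and every piece extends to a cycle whose
    other flags go through hyperplanes containing e, by a prism in the
    direction F |-> F v e.  Subtracting these leaves a cycle whose hyperplanes
    all contain e; all the flats in its flags must then contain e, so that it is
    a cycle over G v e, whose corank is smaller.

    Since m_F is the product of the x_i with i outside F, minimality holds
    because the differential goes from a flat to strictly larger ones. *)

From HB Require Import structures.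
Require Import Defs.
From mathcomp Require Import all_boot all_order all_algebra.
From mathcomp Require Import zify.

Set Implicit Arguments.
Unset Strict Implicit.
Unset Printing Implicit Defensive.

Import GRing.Theory.
Local Open Scope ring_scope.

(** * Rank and closure in a matroid *)

Section MatroidRank.
Variables (n : nat) (M : matroid n).
Implicit Types (A B F G H T I J : {set 'I_n}) (x e : 'I_n).
Local Notation rk := (mrank M).
Local Notation cl := (mclosure M).

Lemma mrank_max A I : I \in indep M -> I \subset A -> (#|I| <= rk A)%N.
Proof. by move=> II IA; rewrite /mrank (bigmax_sup I) // II IA. Qed.

(** Augment [I] from a largest independent subset of [A]: the added elements stay inside [A], and
    the deficit [rk A - #|I|] drops each time. *)
Lemma indep_extend A I : I \in indep M -> I \subset A ->
  exists J, [/\ J \in indep M, I \subset J, J \subset A & #|J| = rk A].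
Proof.
move: {2}(rk A - #|I|)%N (leqnn (rk A - #|I|)) => m.
elim: m I => [|m IH] I leI II IA.
  exists I; split=> //; apply/eqP; rewrite eqn_leq mrank_max //.
  by rewrite -subn_eq0; move: leI; rewrite leqn0.
have [J /andP[JI JA] rJ] : {J : {set 'I_n} | (J \in indep M) && (J \subset A) & rk A = #|J|}.
  apply: (@eq_bigmax_cond _ [pred J | (J \in indep M) && (J \subset A)] (fun J => #|J|)).
  by apply/card_gt0P; exists I; rewrite inE II IA.
have [lt|ge] := ltnP #|I| #|J|; last first.
  by exists I; split=> //; apply/eqP; rewrite eqn_leq mrank_max // rJ.
have [x] := indep_aug II JI lt.
rewrite inE => /andP[xI xJ] xII.
have xA : x |: I \subset A by rewrite subUset sub1set (subsetP JA) ?IA.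
case: (IH (x |: I)) => // [|K [KI IK KA Kr]].
  by rewrite cardsU1 xI; move: leI; clear; lia.
by exists K; split=> //; apply: subset_trans IK; apply: subsetU1.
Qed.

Lemma mrank_basis A : exists J, [/\ J \in indep M, J \subset A & #|J| = rk A].
Proof. by have [J [? ? ? ?]] := indep_extend (indep0 M) (sub0set A); exists J. Qed.

Lemma mrankS A B : A \subset B -> (rk A <= rk B)%N.
Proof.
move=> AB; have [J [JI JA <-]] := mrank_basis A.
by rewrite mrank_max // (subset_trans JA).
Qed.

Lemma mrankU1_le x A : (rk (x |: A) <= (rk A).+1)%N.
Proof.
have [J [JI JA <-]] := mrank_basis (x |: A).
have : (#|J :\ x| <= rk A)%N.
  apply: mrank_max; first by apply: indepS JI _; apply: subD1set.
  by rewrite subDset.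
move=> le; rewrite (cardsD1 x J) -add1n leq_add //; exact: leq_b1.
Qed.

Lemma sub_mclosure A : A \subset cl A.
Proof. by apply/subsetP=> x xA; rewrite inE (setUidPr _) ?sub1set. Qed.

(** A basis [J] of [A] cannot be enlarged inside [cl A]: a further [y] would make [y |: J]
    independent in [y |: A], whose rank is still that of [A]. *)
Lemma mrank_mclosure A : rk (cl A) = rk A.
Proof.
apply/eqP; rewrite eqn_leq (mrankS (sub_mclosure A)) andbT.
have [J [JI JA Jr]] := mrank_basis A.
have [K [KI JK KA <-]] := indep_extend JI (subset_trans JA (sub_mclosure A)).
rewrite leqNgt -Jr; apply/negP => lt.
have [y yK yJ] : exists2 y, y \in K & y \notin J.
  by apply/subsetPn; apply: contraL lt => /subset_leq_card; rewrite -leqNgt.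
have := subsetP KA _ yK; rewrite inE => /eqP ry.
have : (#|y |: J| <= rk (y |: A))%N.
  apply: mrank_max; last exact: setUS.
  by apply: indepS KI _; rewrite subUset sub1set yK.
by rewrite cardsU1 yJ ry Jr ltnn.
Qed.

(** By contraposition. If [x] raises the rank of [B], extend a basis of [A] to one of [B] and then
    to one of [x |: B]. The last one must contain [x], so [x] can be added to the basis of [A] and
    raises its rank too. *)
Lemma mclosureS A B : A \subset B -> cl A \subset cl B.
Proof.
move=> AB; apply/subsetP=> x; rewrite !inE => /eqP rA; apply: contraLR (eqxx (rk A)).
move=> rB; have rxB : rk (x |: B) = (rk B).+1.
  by apply/eqP; rewrite eqn_leq mrankU1_le ltn_neqAle eq_sym rB mrankS ?subsetU1.
have xB : x \notin B.
  by apply/negP=> xB; move: rxB; rewrite (setUidPr _) ?sub1set // => /n_Sn.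
have [J [JI JA Jr]] := mrank_basis A.
have [K [KI JK KB Kr]] := indep_extend JI (subset_trans JA AB).
have [L [LI KL LB Lr]] := indep_extend KI (subset_trans KB (subsetU1 x B)).
have xL : x \in L.
  apply: contraLR (ltnSn (rk B)) => xL; rewrite -leqNgt -rxB -Lr mrank_max //.
  apply/subsetP=> y yL; have := subsetP LB y yL; rewrite in_setU1 => /predU1P[yx|//].
  by rewrite yx (negbTE xL) in yL *.
have : (#|x |: J| <= rk (x |: A))%N.
  apply: mrank_max; last exact: setUS.
  by apply: indepS LI _; rewrite subUset sub1set xL (subset_trans JK).
have xJ : x \notin J by apply: contra xB => xJ; rewrite (subsetP AB) ?(subsetP JA).
by rewrite cardsU1 xJ rA Jr ltnn.
Qed.

Lemma flat_mclosure A : flat M (cl A).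
Proof.
rewrite /flat eqEsubset sub_mclosure andbT; apply/subsetP=> x; rewrite !inE => /eqP rx.
rewrite eqn_leq (mrankS (subsetU1 _ _)) andbT -[X in (_ <= X)%N](mrank_mclosure A) -rx.
by rewrite mrankS // setUS // sub_mclosure.
Qed.

Lemma flatT : flat M setT.
Proof. by rewrite /flat eqEsubset subsetT sub_mclosure. Qed.

Lemma mclosure_sub A F : flat M F -> A \subset F -> cl A \subset F.
Proof. by move=> /eqP fF AF; rewrite -fF mclosureS. Qed.

Lemma mrank_flatU1 e F : flat M F -> e \notin F -> rk (e |: F) = (rk F).+1.
Proof.
move=> /eqP fF; rewrite -{1}fF inE => ne; apply/eqP.
by rewrite eqn_leq mrankU1_le ltn_neqAle eq_sym ne mrankS ?subsetU1.
Qed.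

Lemma flat_eq F G : flat M F -> F \subset G -> (rk G <= rk F)%N -> F = G.
Proof.
move=> fF FG le; apply/eqP; rewrite eqEsubset FG; apply/subsetP=> x xG.
apply: contraLR (ltnSn (rk F)) => xF; rewrite -leqNgt -(mrank_flatU1 fF xF).
by apply: leq_trans le; rewrite mrankS // subUset sub1set xG.
Qed.

Lemma mrank_proper F G : flat M F -> F \proper G -> (rk F < rk G)%N.
Proof.
move=> fF pFG; rewrite ltnNge; apply/negP => le.
by move: (pFG); rewrite (flat_eq fF (proper_sub pFG) le) properxx.
Qed.

(** * Flats one rank below a given set, and joins with an element *)

Definition hyperplane_of T H := [&& flat M H, H \proper T & rk T == (rk H).+1].
Local Notation hyp := hyperplane_of.

Lemma hyp_flat T H : hyp T H -> flat M H. Proof. by case/and3P. Qed.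
Lemma hyp_proper T H : hyp T H -> H \proper T. Proof. by case/and3P. Qed.
Lemma hyp_sub T H : hyp T H -> H \subset T. Proof. by case/and3P=> _ /proper_sub. Qed.
Lemma hyp_rank T H : hyp T H -> rk T = (rk H).+1. Proof. by case/and3P=> _ _ /eqP. Qed.

(** The join F v e in the lattice of flats. *)
Definition adj e F := cl (e |: F).

Lemma flat_adj e F : flat M (adj e F). Proof. exact: flat_mclosure. Qed.

Lemma mem_adj e F : e \in adj e F.
Proof. by rewrite (subsetP (sub_mclosure _)) ?setU11. Qed.

Lemma sub_adj e F : F \subset adj e F.
Proof. by rewrite (subset_trans (subsetU1 e F)) ?sub_mclosure. Qed.

Lemma mrank_adj e F : flat M F -> e \notin F -> rk (adj e F) = (rk F).+1.
Proof. by move=> fF eF; rewrite mrank_mclosure mrank_flatU1. Qed.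

Lemma adj_sub e F G : flat M G -> F \subset G -> e \in G -> adj e F \subset G.
Proof. by move=> fG FG eG; rewrite mclosure_sub // subUset sub1set eG. Qed.

Lemma adj_eq e F G : flat M F -> flat M G -> F \subset G -> e \in G ->
  e \notin F -> rk G = (rk F).+1 -> adj e F = G.
Proof.
move=> fF fG FG eG eF r; apply: flat_eq; rewrite ?flat_adj ?adj_sub //.
by rewrite r mrank_adj.
Qed.

Lemma hyp_adj_l e F : flat M F -> e \notin F -> hyp (adj e F) F.
Proof.
move=> fF eF; rewrite /hyperplane_of fF mrank_adj // eqxx andbT properE sub_adj.
by apply: contra eF => /subsetP; apply; apply: mem_adj.
Qed.

(** The element [e] is outside [C] as well, so the join raises the rank of [C] by exactly one. This
    is how the prism moves flags under [H] to hyperplanes containing [e]. *)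
Lemma hyp_adj T H C e : flat M T -> hyp T H -> hyp H C -> e \in T -> e \notin H ->
  hyp T (adj e C).
Proof.
move=> fT hH hC eT eH; have eC : e \notin C by apply: contra eH; apply/subsetP/hyp_sub.
rewrite /hyperplane_of flat_adj mrank_adj ?(hyp_flat hC) //.
rewrite (hyp_rank hH) (hyp_rank hC) eqxx andbT properEneq.
rewrite adj_sub // ?(subset_trans (hyp_sub hC)) ?(hyp_sub hH) // andbT.
apply/eqP=> E; have := mrank_adj (hyp_flat hC) eC.
by rewrite E (hyp_rank hH) (hyp_rank hC); lia.
Qed.


(* If a proper flat F of T is not a hyperplane of T, it can be enlarged by any
   element outside the closure of F and x without capturing x. *)
Lemma exists_hyp F T x : flat M F -> flat M T -> F \subset T -> x \in T ->
  x \notin F -> exists H, [/\ hyp T H, F \subset H & x \notin H].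
Proof.
move=> + fT; move: {2}(rk T - rk F)%N (leqnn (rk T - rk F)) => m.
elim: m F => [|m IH] F le fF FT xT xF.
  by move: xF; rewrite (flat_eq fF FT) ?xT //; lia.
have AT : adj x F \subset T by rewrite adj_sub.
have [/exists_inP[e eT eA] | TA] := boolP [exists e in T, e \notin adj x F]; last first.
  have E : adj x F = T.
    apply/eqP; rewrite eqEsubset AT; apply/subsetP=> e eT.
    by move: TA; rewrite negb_exists_in => /forall_inP/(_ e eT); rewrite negbK.
  by exists F; split=> //; rewrite -E hyp_adj_l.
have eF : e \notin F by apply: contra eA; apply/subsetP/sub_adj.
(* Exchange property: if F v e contained [x], it would equal F v x, which omits [e]. *)
have xA : x \notin adj e F.
  apply: contra eA => xA; rewrite (adj_eq fF (flat_adj e F)) ?mem_adj ?sub_adj //.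
  exact: mrank_adj.
have [||H [hH sH xH]] := IH (adj e F) _ (flat_adj e F) _ xT xA.
- by rewrite mrank_adj //; move: le; clear; lia.
- exact: adj_sub.
by exists H; split=> //; apply: subset_trans sH; apply: sub_adj.
Qed.

End MatroidRank.

(** * Cycles on saturated flags *)

Section FlagCycles.
Variables (n : nat) (k : fieldType) (M : matroid n).
Implicit Types (C D F G H T : {set 'I_n}) (e : 'I_n) (m : nat).
Implicit Types (c s : seq {set 'I_n}) (y z : seq {set 'I_n} -> k).
Local Notation rk := (mrank M).
Local Notation hyp := (hyperplane_of M).
Local Notation adj := (adj M).

(* Top-dimensional cycles on saturated flags T > C_1 > ... > C_m above G,
   listed from the largest flat down.  In such a cycle the faces missing
   different ranks cannot cancel each other, so the boundary splits into one
   equation for each rank. *)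
Record cyc G T m z : Prop := Cyc {
  cyc_supp : forall c, z c != 0 ->
    [/\ size c = m, path hyp T c & G \subset last T c];
  cyc_face : forall s1 s2, (size s1 + size s2).+1 = m ->
    \sum_C z (s1 ++ C :: s2) = 0 }.

Lemma cyc_face_all G T m z s1 s2 : (0 < m)%N -> cyc G T m z ->
  \sum_C z (s1 ++ C :: s2) = 0.
Proof.
move=> m0 [supp face]; have [/eqP E|ne] := boolP ((size s1 + size s2).+1 == m).
  exact: face.
apply: big1 => C _; apply/eqP; apply: contraNT ne => /supp[].
by rewrite size_cat /= addnS => ->.
Qed.

(** Recursion on the largest flat of a flag: the face equations with [s1] nonempty are those of the
    slices below each hyperplane, and those with [s1] empty form the last clause. *)
Lemma cycS G T m z : cyc G T m.+1 z <->
  [/\ z [::] = 0, forall H c, ~~ hyp T H -> z (H :: c) = 0,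
      forall H, hyp T H -> cyc G H m (fun c => z (H :: c))
    & forall c, \sum_H z (H :: c) = 0].
Proof.
split=> [cz|[z0 zN zH zs]].
  split.
  - by apply/eqP; apply/negP => /negP/(cyc_supp cz)[].
  - move=> H c hH; apply/eqP; apply: contraNT hH => /(cyc_supp cz)[_ /=].
    by case/andP.
  - move=> H hH; split=> [c /(cyc_supp cz)[/= [sc] /andP[_ p] l]|s1 s2 E].
      by split.
    by have := @cyc_face_all _ _ _ _ (H :: s1) s2 (ltn0Sn m) cz.
  - by move=> c; exact: (@cyc_face_all _ _ _ _ [::] c (ltn0Sn m) cz).
split=> [[|H c] nz|[|H s1] s2 E] /=.
- by rewrite z0 eqxx in nz.
- have hH : hyp T H by apply: contraNT nz => /zN->.
  have [/= -> -> ->] := cyc_supp (zH H hH) nz.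
  by rewrite hH.
- exact: zs.
- have [hH|nH] := boolP (hyp T H); last by apply: big1 => C _; apply: zN.
  by apply: (cyc_face (zH H hH)); case: E => /= <-.
Qed.

Lemma cyc_ext G T m z1 z2 : z1 =1 z2 -> cyc G T m z1 -> cyc G T m z2.
Proof.
move=> E [supp face]; split=> [c|s1 s2 /face f0]; first by rewrite -E; apply: supp.
by apply: etrans f0; apply: eq_bigr => C _; rewrite E.
Qed.

Lemma cyc_zero G T m : cyc G T m (fun=> 0).
Proof. by split=> [c|s1 s2 _]; rewrite ?eqxx // big1. Qed.

Lemma cyc_add G T m z1 z2 :
  cyc G T m z1 -> cyc G T m z2 -> cyc G T m (fun c => z1 c + z2 c).
Proof.
move=> [p1 f1] [p2 f2]; split=> [c|s1 s2 E]; last by rewrite big_split /= f1 ?f2 ?addr0.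
have [->|/p1 //] := eqVneq (z1 c) 0; rewrite add0r; exact: p2.
Qed.

Lemma cyc_scale a G T m z : cyc G T m z -> cyc G T m (fun c => a * z c).
Proof.
move=> [p f]; split=> [c|s1 s2 E]; last by rewrite -mulr_sumr f ?mulr0.
by rewrite mulf_eq0 negb_or => /andP[_ /p].
Qed.

Lemma cyc_sub G T m z1 z2 :
  cyc G T m z1 -> cyc G T m z2 -> cyc G T m (fun c => z1 c - z2 c).
Proof.
move=> c1 /(cyc_scale (-1)) c2; apply: cyc_ext (cyc_add c1 c2) => c.
by rewrite mulN1r.
Qed.

Lemma cyc_big (I : finType) (P : pred I) G T m (z : I -> seq {set 'I_n} -> k) :
  (forall i, P i -> cyc G T m (z i)) -> cyc G T m (fun c => \sum_(i | P i) z i c).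
Proof.
move=> cz; split=> [c|s1 s2 E]; last first.
  by rewrite exchange_big big1 // => i Pi; apply: (cyc_face (cz i Pi)).
have [/exists_inP[i Pi /(cyc_supp (cz i Pi))] //|] := boolP [exists (i | P i), z i c != 0].
rewrite negb_exists_in => /forall_inP zi; rewrite big1 ?eqxx // => i Pi.
by apply/eqP; rewrite -[_ == _]negbK zi.
Qed.

Lemma cycW G' G T m z : G' \subset G -> cyc G T m z -> cyc G' T m z.
Proof.
move=> s [supp face]; split=> // c /supp[sc p l]; split=> //.
exact: subset_trans l.
Qed.

Lemma path_hyp_flat T c : flat M T -> path hyp T c -> flat M (last T c).
Proof. by elim: c T => //= H c IH T _ /andP[/hyp_flat fH]; apply: IH. Qed.

Lemma path_hyp_sub T c : path hyp T c -> last T c \subset T.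
Proof.
elim: c T => //= H c IH T /andP[hH /IH l]; exact: subset_trans l (hyp_sub hH).
Qed.

(** Among flats, C v e is the only cover of [C] that contains [e]. If the second flat of a flag
    omits [e], the equation for the face missing the first flat therefore has a single term, which
    must vanish. So [e] propagates down the flag. *)
Lemma cyc_mem_last e G T m z : flat M T ->
    cyc G T m.+1 z -> (forall H c, e \notin H -> z (H :: c) = 0) ->
  forall c, z c != 0 -> e \in last T c.
Proof.
elim: m T z => [|m IH] T z fT cz ze [|H c] nz.
- by have [] := cyc_supp cz nz.
- have eH : e \in H by apply: contraNT nz => /ze->.
  by have [[/size0nil ->]] := cyc_supp cz nz.
- by have [] := cyc_supp cz nz.
have eH : e \in H by apply: contraNT nz => /ze->.
have [z0 zN zH zs] := (cycS G T m.+1 z).1 cz.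
have hH : hyp T H by apply: contraNT nz => /zN->.
apply: (IH H (fun c => z (H :: c)) (hyp_flat hH) (zH H hH)) nz => C c' eC.
have [_ zHN _ _] := (cycS G H m _).1 (zH H hH).
have [hC|nC] := boolP (hyp H C); last exact: zHN.
have := zs (C :: c'); rewrite (bigD1 H) //= big1 ?addr0 // => H' nH'.
apply/eqP; apply: contraNT nH' => nz'.
have eH' : e \in H' by apply: contraNT nz' => /ze->.
have hH' : hyp T H' by apply: contraNT nz' => /zN->.
have [_ zHN' _ _] := (cycS G H' m _).1 (zH H' hH').
have hC' : hyp H' C by apply: contraNT nz' => /zHN'->.
have fC := hyp_flat hC; apply/eqP.
rewrite -(adj_eq fC (hyp_flat hH') (hyp_sub hC') eH' eC (hyp_rank hC')).
by rewrite -(adj_eq fC (hyp_flat hH) (hyp_sub hC) eH eC (hyp_rank hC)).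
Qed.

Lemma cyc_adj e G T m z : flat M T ->
    cyc G T m.+1 z -> (forall H c, e \notin H -> z (H :: c) = 0) ->
  cyc (adj e G) T m.+1 z.
Proof.
move=> fT cz ze; split=> [c nz|]; last exact: cyc_face cz.
have [sc p l] := cyc_supp cz nz; split=> //.
by rewrite adj_sub ?path_hyp_flat ?(cyc_mem_last fT cz ze).
Qed.

(* Extends a cycle y below the hyperplane H to a cycle below H v e whose flags
   pass through H, where it restricts to y, or through a hyperplane containing
   e.  It is the prism over y in the direction e, closed by the cone from
   F v e over y v e. *)
Fixpoint prism e F m H y c : k :=
  if c is H' :: c' then
    y c' *+ (H' == H) -
    (if m is m'.+1 then
       \sum_(C | hyp H C && (adj e C == H')) prism e F m' C (fun s => y (C :: s)) c'
     else y c' *+ (H' == adj e F))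
  else 0.

Lemma prism_nil e F m H y : prism e F m H y [::] = 0.
Proof. by case: m. Qed.

Lemma prism_eq e F m H y1 y2 : y1 =1 y2 -> prism e F m H y1 =1 prism e F m H y2.
Proof.
elim: m H y1 y2 => [|m IH] H y1 y2 E [|H' c] //=; rewrite !E //.
by congr (_ - _); apply: eq_bigr => C _; apply: IH => s.
Qed.

Lemma prism_sum (I : finType) e F m H (y : I -> seq {set 'I_n} -> k) c :
  prism e F m H (fun s => \sum_i y i s) c = \sum_i prism e F m H (y i) c.
Proof.
elim: m H y c => [|m IH] H y [|H' c] /=; try by rewrite big1.
  by rewrite sumrB -!sumrMnl.
rewrite sumrB -!sumrMnl; congr (_ - _); rewrite exchange_big /=.
by apply: eq_bigr => C _; rewrite IH.
Qed.

Lemma prism_zero e F m H y c : (forall s, y s = 0) -> prism e F m H y c = 0.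
Proof.
move=> y0; rewrite (@prism_eq _ _ _ _ _ (fun s => \sum_(i < 0) 0)).
  by rewrite prism_sum big_ord0.
by move=> s; rewrite big_ord0.
Qed.

(** The correction terms all start at a join with [e], which cannot equal [H]; only the copy of [y]
    remains under [H]. *)
Lemma prism_top e F m H y c : e \notin H -> prism e F m H y (H :: c) = y c.
Proof.
move=> eH; have neH C : (adj e C == H) = false.
  by apply: contraNF eH => /eqP <-; apply: mem_adj.
case: m => [|m] /=; rewrite eqxx.
  by rewrite eq_sym neH subr0.
by rewrite big1 ?subr0 // => C; rewrite neH andbF.
Qed.

Lemma prism_other e F m H y H' c : e \notin H' -> H' != H ->
  prism e F m H y (H' :: c) = 0.
Proof.
move=> eH /negbTE ne; have neH C : (adj e C == H') = false.
  by apply: contraNF eH => /eqP <-; apply: mem_adj.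
case: m => [|m] /=; rewrite ne sub0r ?[H' == adj _ _]eq_sym ?neH ?oppr0 //.
by rewrite big1 ?oppr0 // => C; rewrite neH andbF.
Qed.

Lemma sum_mulrb_eq (y : k) H : \sum_H' y *+ (H' == H) = y.
Proof.
rewrite (bigD1 H) //= eqxx big1 ?addr0 // => H' /negbTE-> //.
Qed.

(** As [D] contains [e], each prism contributes only its terms over flats [B] with B v e = D. After
    exchanging sums, [y] is summed over its first flat, which gives zero by its face equation. For
    [m = 0] that sum appears at once. *)
Lemma sum_prism_mem e F m H y D c : e \notin H -> e \in D -> cyc F H m.+1 y ->
  \sum_(C | hyp H C) prism e F m C (fun s => y (C :: s)) (D :: c) = 0.
Proof.
move=> eH eD /cycS[_ yN yC ys].
have neD C : hyp H C -> (D == C) = false.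
  move=> hC; apply: contraNF eH => /eqP E; apply: (subsetP (hyp_sub hC)).
  by rewrite -E.
case: m yC => [|m] yC /=.
  rewrite (eq_bigr (fun C => - (y (C :: c) *+ (D == adj e F)))); last first.
    by move=> C /neD->; rewrite sub0r.
  rewrite sumrN sumrMnl.
  have := ys c; rewrite (bigID (hyp H)) /= [X in _ + X]big1 => [|C /yN //].
  by rewrite addr0 => ->; rewrite mul0rn oppr0.
(* Zero is rewritten as prisms over the full first-flat sums of [y]; linearity and the support of
   [y] then lead back to the left side. *)
transitivity (- \sum_(B | adj e B == D)
    prism e F m B (fun s => \sum_C y [:: C, B & s]) c); last first.
  by rewrite big1 ?oppr0 // => B _; apply: prism_zero => s.
under [in RHS]eq_bigr => B _ do rewrite prism_sum.
rewrite [in RHS]exchange_big /= [in RHS](bigID (hyp H)) /= [X in _ = - (_ + X)]big1 => [|C nC]; last first.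
  by apply: big1 => B _; apply: prism_zero => s; apply: yN.
rewrite addr0 -sumrN; apply: eq_bigr => C hC; rewrite neD // sub0r; congr (- _).
rewrite [RHS](bigID (hyp C)) /= [X in _ = _ + X]big1 ?addr0.
  by apply: eq_bigl => B; rewrite andbC.
move=> B /andP[_ nB]; apply: prism_zero => s.
by have [_ h _ _] := (cycS _ _ _ _).1 (yC C hC); apply: h.
Qed.

(** The slices are [y] and shorter prisms, which are cycles by induction. For the face missing the
    first flat, let [D] be the next flat. If [D] contains [e], the prisms cancel among themselves;
    otherwise only the prism over [D] survives, and it cancels the copy of [y] through [H]. *)
Lemma prism_cyc e F m T H y : flat M T -> flat M F -> hyp T H -> e \in T ->
    e \notin H -> F \subset H -> rk H = (rk F + m.+1)%N -> cyc F H m y ->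
  cyc F T m.+1 (prism e F m H y).
Proof.
move=> fT fF; elim: m T H y fT => [|m IH] T H y fT hH eT eH FH rH cy.
  (* For [m = 0], [F] is a hyperplane of [H], and the prism is a multiple of the difference of the
     flags consisting of [H] and of F v e. *)
  have hF : hyp H F.
    rewrite /hyperplane_of fF rH addn1 eqxx andbT properEneq FH andbT.
    by apply/eqP=> E; move: rH; rewrite E; lia.
  have hA := hyp_adj fT hH hF eT eH.
  apply/cycS; split=> //=.
  - move=> H' c nH'; have [E|_] := eqVneq H' H; first by rewrite E hH in nH'.
    have [E|_] := eqVneq H' (adj e F); first by rewrite E hA in nH'.
    by rewrite subr0.
  - move=> H' hH'; apply: cyc_sub; split=> // c.
      have [->|_] := eqVneq H' H; rewrite ?eqxx // mulr1n.
      by move=> /(cyc_supp cy).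
    have [->|_] := eqVneq H' (adj e F); rewrite ?eqxx // mulr1n.
    by move=> /(cyc_supp cy)[/size0nil-> _ _]; rewrite /= sub_adj.
  - by move=> c; rewrite sumrB !sum_mulrb_eq subrr.
have [y0 yN yC ys] := (cycS _ _ _ _).1 cy.
apply/cycS; split=> //.
- move=> H' c nH' /=; have [E|_] := eqVneq H' H; first by rewrite E hH in nH'.
  rewrite big1 ?subr0 // => C /andP[hC /eqP E].
  by rewrite -E (hyp_adj fT hH hC eT eH) in nH'.
- move=> H' hH' /=; apply: cyc_sub.
    have [->|_] := eqVneq H' H; first exact: (cyc_ext _ cy).
    exact: (cyc_ext _ (@cyc_zero _ _ _)).
  apply: cyc_big => C /andP[hC /eqP <-].
  have eC : e \notin C by apply: contra eH; exact: (subsetP (hyp_sub hC)).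
  (* If [C] does not contain [F], no flag through [C] ends above [F], so this slice of [y]
     vanishes. *)
  have [FC|nFC] := boolP (F \subset C).
    apply: IH; rewrite ?flat_adj ?hyp_adj_l ?mem_adj ?(hyp_flat hC) //; last exact: yC.
    by apply: succn_inj; rewrite -(hyp_rank hC) rH addnS.
  apply: (@cyc_ext _ _ _ (fun=> 0)) => [c|]; last exact: cyc_zero.
  rewrite prism_zero // => s.
  apply/eqP; apply: contraNT nFC => /(cyc_supp cy)[_ /= /andP[_ p] l].
  exact: subset_trans l (path_hyp_sub p).
move=> c /=; rewrite sumrB sum_mulrb_eq.
(* Summing over all [H'] undoes the sorting of the hyperplanes [C] of [H] by their join with [e]. *)
rewrite -(partition_big (adj e) predT) //=.
case: c => [|D c]; first by rewrite y0 big1 ?subr0 // => C _; rewrite prism_nil.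
have [eD|eD] := boolP (e \in D).
  rewrite sum_prism_mem // subr0 yN //.
  by apply: contra eH => /hyp_sub/subsetP; apply.
rewrite (eq_bigr (fun C => y (D :: c) *+ (C == D))); last first.
  move=> C hC; have [->|ne] := eqVneq C D; first by rewrite prism_top.
  by rewrite prism_other // eq_sym.
rewrite -[y (D :: c) in X in X - _](sum_mulrb_eq _ D) (bigID (hyp H)) /=.
rewrite [X in _ + X - _]big1 ?addr0 ?subrr // => C nC.
by have [E|//] := eqVneq C D; rewrite -E yN.
Qed.

(** Exactness in explicit form: [y] is a preimage of [z] under the differential, and [y F] is its
    component at a flat [F] lying [m.+1] ranks below [T]. *)
Definition decomposable G T m z := exists y : {set 'I_n} -> seq {set 'I_n} -> k,
  [/\ forall F c, y F c != 0 ->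
        [/\ flat M F, G \subset F, F \subset T & rk T = (rk F + m.+1)%N],
      forall F, cyc F T m (y F) & forall c, z c = \sum_F y F c].

Lemma decomposable1 F G T m z : flat M F -> G \subset F -> F \subset T ->
  rk T = (rk F + m.+1)%N -> cyc F T m z -> decomposable G T m z.
Proof.
move=> fF GF FT r cz; exists (fun F' c => z c *+ (F' == F)); split.
- by move=> F' c; have [->|] := eqVneq F' F; rewrite ?eqxx.
- move=> F'; have [->|_] := eqVneq F' F; first exact: (cyc_ext _ cz).
  exact: (cyc_ext _ (@cyc_zero _ _ _)).
- by move=> c; rewrite sum_mulrb_eq.
Qed.

Lemma decomposable_ext G T m z1 z2 :
  z1 =1 z2 -> decomposable G T m z1 -> decomposable G T m z2.
Proof. by move=> E [y [? ? h]]; exists y; split=> // c; rewrite -E. Qed.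

Lemma decomposable0 G T m : decomposable G T m (fun=> 0).
Proof.
exists (fun _ _ => 0); split=> [F c|F|c]; rewrite ?eqxx ?big1 //; exact: cyc_zero.
Qed.

Lemma decomposable_add G T m z1 z2 : decomposable G T m z1 ->
  decomposable G T m z2 -> decomposable G T m (fun c => z1 c + z2 c).
Proof.
move=> [y1 [p1 c1 e1]] [y2 [p2 c2 e2]]; exists (fun F c => y1 F c + y2 F c); split.
- move=> F c; have [->|/p1 //] := eqVneq (y1 F c) 0; rewrite add0r; exact: p2.
- by move=> F; apply: cyc_add.
- by move=> c; rewrite e1 e2 big_split.
Qed.

Lemma decomposable_big (I : finType) G T m (z : I -> seq {set 'I_n} -> k) :
  (forall i, decomposable G T m (z i)) -> decomposable G T m (fun c => \sum_i z i c).
Proof.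
move=> /fin_all_exists[y yP]; exists (fun F c => \sum_i y i F c); split.
- move=> F c; have [/existsP[i]|] := boolP [exists i, y i F c != 0].
    by case: (yP i) => h _ _ /h.
  rewrite negb_exists => /forallP yi; rewrite big1 ?eqxx // => i _.
  by apply/eqP; rewrite -[_ == _]negbK yi.
- by move=> F; apply: cyc_big => i _; case: (yP i).
- by move=> c; rewrite exchange_big; apply: eq_bigr => i _; case: (yP i).
Qed.

Lemma decomposableW G' G T m z : G' \subset G ->
  decomposable G T m z -> decomposable G' T m z.
Proof.
move=> s [y [p c1 e1]]; exists y; split=> // F c /p[? GF ? ?]; split=> //.
exact: subset_trans GF.
Qed.

Lemma decomposable_cyc G T m z : decomposable G T m z -> cyc G T m z.
Proof.
case=> y [p cy E]; apply: (@cyc_ext _ _ _ (fun c => \sum_F y F c)) => [c|]; first by rewrite E.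
apply: cyc_big => F _; split=> [c nz|]; last exact: cyc_face (cy F).
have [_ GF _ _] := p F c nz; exact: (cyc_supp (cycW GF (cy F)) nz).
Qed.

(* The prisms reduce z to a cycle whose hyperplanes all contain e, that is, a
   cycle over G v e; then one recurses on the corank of G. *)
Lemma cyc_decomposable G T m z : flat M T -> flat M G -> G \subset T ->
  (rk G + m < rk T)%N -> cyc G T m z -> decomposable G T m z.
Proof.
elim: m G T z => [|m IHm] G T z fT fG GT.
  rewrite addn0 => lt cz.
  have /subsetPn[x xT xG] : ~~ (T \subset G).
    by apply/negP => /(mrankS M); rewrite leqNgt lt.
  (* Here [z] is a scalar on the empty flag, and any hyperplane above [G] can carry it. *)
  have [H [hH GH _]] := exists_hyp fG fT GT xT xG.
  apply: (@decomposable1 H); rewrite ?(hyp_flat hH) ?(hyp_sub hH) ?addn1 ?(hyp_rank hH) //.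
  split=> // c /(cyc_supp cz)[/size0nil-> _ _] /=; split=> //; exact: (hyp_sub hH).
move: {2}(rk T - rk G)%N (leqnn (rk T - rk G)) => r.
elim: r G z fG GT => [|r IHr] G z fG GT le lt cz; first by lia.
(* If [G] already has the required rank, [z] placed at [G] is its own decomposition. *)
have [/eqP E|ne] := boolP (rk T == rk G + m.+2)%N; first exact: (@decomposable1 G).
have /subsetPn[e eT eG] : ~~ (T \subset G).
  by apply/negP => /(mrankS M); move: lt; clear; lia.
have [z0 zN zH zs] := (cycS _ _ _ _).1 cz.
(* Among hyperplanes omitting [e], [z' H] meets at most [H], where it agrees with [z]; hence the
   corrections for different [H] do not interfere. *)
have /fin_all_exists[z' z'P] (H : {set 'I_n}) : exists z' : seq {set 'I_n} -> k,
    [/\ decomposable G T m.+1 z',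
        e \notin H -> forall c, z' (H :: c) = z (H :: c)
      & forall H' c, e \notin H' -> H' != H -> z' (H' :: c) = 0].
  have [hH|nH] := boolP [&& hyp T H, e \notin H & G \subset H]; last first.
    exists (fun=> 0); split=> // [|eH c]; first exact: decomposable0.
    apply/esym/eqP; apply: contraNT nH => nz; rewrite eH /=.
    have [_ /= /andP[-> p] l] := cyc_supp cz nz.
    exact: subset_trans l (path_hyp_sub p).
  have /and3P[hTH eH GH] := hH.
  have [||y [yP cy yE]] := IHm G H (fun c => z (H :: c)) (hyp_flat hTH) fG GH.
  - by move: lt; rewrite (hyp_rank hTH); clear; lia.
  - exact: zH.
  exists (fun c => \sum_F prism e F m H (y F) c); split=> [|_ c|H' c eH' nH'].
  - apply: decomposable_big => F.
    have [fGF|nF] := boolP [&& flat M F, G \subset F, F \subset H & rk H == (rk F + m.+1)%N].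
      have /and4P[fF GF FH /eqP rF] := fGF.
      apply: (@decomposable1 F); rewrite ?(subset_trans FH) ?(hyp_sub hTH) //.
        by rewrite (hyp_rank hTH) rF !addnS.
      exact: prism_cyc.
    apply: decomposable_ext (@decomposable0 _ _ _) => c; rewrite prism_zero // => s.
    by apply/eqP; apply: contraNT nF => /yP[-> -> -> ->]; rewrite eqxx.
  - by rewrite yE; apply: eq_bigr => F _; rewrite prism_top.
  - by apply: big1 => F _; rewrite prism_other.
pose w c := z c - \sum_H z' H c.
have cw : cyc G T m.+1 w.
  by apply: cyc_sub => //; apply: cyc_big => H _; apply: decomposable_cyc; case: (z'P H).
have we H c : e \notin H -> w (H :: c) = 0.
  move=> eH; rewrite /w (bigD1 H) //= big1 => [|H' neH].
    by case: (z'P H) => _ -> // _; rewrite addr0 subrr.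
  by case: (z'P H') => _ _ ->; rewrite // eq_sym.
(* Passing to G v e lowers the corank by one, and the excluded equality [ne] preserves the strict
   rank bound. *)
have dw : decomposable G T m.+1 w.
  apply: (@decomposableW _ (adj e G)); first exact: sub_adj.
  apply: IHr; rewrite ?flat_adj ?adj_sub ?mrank_adj //.
  - by move: le lt; clear; lia.
  - by move: lt; move/eqP: ne; clear; lia.
  - exact: cyc_adj.
have ds : decomposable G T m.+1 (fun c => \sum_H z' H c).
  by apply: decomposable_big => H; case: (z'P H).
by apply: decomposable_ext (decomposable_add dw ds) => c; rewrite /w /= subrK.
Qed.

End FlagCycles.

(** * The graded poset of flats *)

Section FlatPoset.
Variables (n : nat) (M : matroid n).
Implicit Types (C D F G H T : {set 'I_n}).
Local Notation rk := (mrank M).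
Local Notation hyp := (hyperplane_of M).

(** The rank is injective on a chain of flats, with values strictly above [rk F] and at most
    [rk setT]. *)
Lemma card_chain_le F (K : {set {set 'I_n}}) : flat M F -> is_chain K ->
  {in K, forall G, flat M G && ltPf G F} -> (#|K| <= rk setT - rk F)%N.
Proof.
move=> fF /forall_inP chK KP; rewrite cardE -(size_map rk).
rewrite -(size_iota (rk F).+1 (rk setT - rk F)); apply: uniq_leq_size.
  rewrite map_inj_in_uniq ?enum_uniq // => G G'; rewrite !mem_enum => GK GK' E.
  have /andP[fG _] := KP _ GK; have /andP[fG' _] := KP _ GK'.
  have /forall_inP/(_ G' GK')/or3P[/eqP //|lt|lt] := chK G GK.
    by have := mrank_proper fG' lt; rewrite E ltnn.
  by have := mrank_proper fG lt; rewrite E ltnn.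
move=> _ /mapP[G + ->]; rewrite mem_enum mem_iota => /KP/andP[fG pFG].
have lt := mrank_proper fF pFG; rewrite lt addSn ltnS subnKC ?mrankS ?subsetT //.
Qed.

(** Joining one element at a time raises the rank by one, so the chain obtained skips no rank. *)
Lemma exists_max_chain F : flat M F -> exists K : {set {set 'I_n}},
  [/\ is_chain K, {in K, forall G, flat M G && ltPf G F}
    & #|K| = (rk setT - rk F)%N].
Proof.
move: {2}(rk setT - rk F)%N (erefl (rk setT - rk F)%N) => r.
elim: r F => [|r IH] F E fF.
  exists set0; split; rewrite ?cards0 ?E //.
    by apply/forall_inP => G; rewrite inE.
  by move=> G; rewrite inE.
have /subsetPn[e _ eF] : ~~ (setT \subset F).
  by apply/negP => /(mrankS M); rewrite -subn_eq0 E.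
have [|K [/forall_inP chK KP cK]] := IH (adj M e F) _ (flat_adj M e F).
  by rewrite mrank_adj // subnS E.
have pA := hyp_proper (hyp_adj_l fF eF).
exists (adj M e F |: K); split.
- apply/forall_inP => G; rewrite in_setU1 => /predU1P[->|GK].
    apply/forall_inP => G'; rewrite in_setU1 => /predU1P[->|GK']; first by rewrite eqxx.
    by have /andP[_ ->] := KP _ GK'; rewrite !orbT.
  apply/forall_inP => G'; rewrite in_setU1 => /predU1P[->|GK'].
    by have /andP[_ ->] := KP _ GK; rewrite !orbT.
  by have /forall_inP := chK G GK; apply.
- move=> G; rewrite in_setU1 => /predU1P[->|/KP/andP[-> lt]].
    by rewrite flat_adj.
  exact: proper_trans lt.
rewrite cardsU1 cK E mrank_adj // subnS E /=.
case: (boolP (_ \in K)) => // /KP/andP[_]; by rewrite /ltPf properxx.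
Qed.

Lemma rkP_flat F : flat M F -> rkP M F = (rk setT - rk F)%N.
Proof.
move=> fF; apply/eqP; rewrite eqn_leq; apply/andP; split.
  apply/bigmax_leqP => K /andP[chK /forall_inP KP].
  exact: card_chain_le.
have [K [chK KP <-]] := exists_max_chain fF.
by apply: (bigmax_sup K) => //; rewrite chK; apply/forall_inP.
Qed.

Lemma in_degreeP d F :
  reflect (flat M F /\ rk setT = (rk F + d.+1)%N) (in_degree M d F).
Proof.
rewrite /in_degree; apply: (iffP andP) => [[fF]|[fF E]].
  by rewrite rkP_flat // => /eqP E; split=> //; move: E; clear; lia.
by rewrite rkP_flat // E addKn.
Qed.

Lemma in_degree_neqT d F : in_degree M d F -> F != setT.
Proof. by move=> /in_degreeP[_ E]; apply/eqP => FT; move: E; rewrite FT; lia. Qed.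

Lemma in_degree0 F : in_degree M 0 F = hyp setT F.
Proof.
apply/in_degreeP/and3P => [[fF E]|[fF _ /eqP->]]; last by rewrite addn1.
split; rewrite // ?E ?addn1 // properT; apply/eqP => FT; move: E; rewrite FT; lia.
Qed.

Lemma hyp_atom H : hyp setT H -> atom M H.
Proof.
move=> hH; rewrite /atom (hyp_flat hH) /ltPf (hyp_proper hH) /=.
apply/existsP => -[G /and3P[fG pG pHG]].
have := mrank_proper fG pG; have := mrank_proper (hyp_flat hH) pHG.
by rewrite (hyp_rank hH) ltnS => /leq_trans lt /lt; rewrite ltnn.
Qed.

(** A flat is the intersection of the hyperplanes above it: for each [i] outside [F], one of them
    omits [i]. So the lcm of the labels of the atoms is the squarefree monomial of [F]. *)
Lemma mlabel_flat F : flat M F -> F != setT -> mlabel M F = mexp F.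
Proof.
move=> fF nF; rewrite /mlabel (negbTE nF); apply/mnmP => i.
rewrite (big_morph (fun m : 'X_{1..n} => m i) (id1 := 0%N) (op1 := maxn)); first last.
- by rewrite mnm0E.
- by move=> m1 m2; rewrite mnmE.
apply/eqP; rewrite eqn_leq; apply/andP; split.
  apply/bigmax_leqP => H /andP[_ /orP[/eqP-> //|/proper_sub/subsetP FH]].
  rewrite !mnmE; have [iF|//] := boolP (i \in F); last by rewrite leq_b1.
  by rewrite FH.
rewrite !mnmE; have [//|iF] := boolP (i \in F).
have [H [hH FH iH]] := exists_hyp fF (flatT M) (subsetT F) (in_setT i) iF.
apply: (bigmax_sup H); last by rewrite mnmE iH.
rewrite hyp_atom // /ltPf properEneq FH andbT eq_sym; exact: orbN.
Qed.

Lemma mlabel_degree d F : in_degree M d F -> mlabel M F = mexp F.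
Proof.
move=> dF; have [fF _] := in_degreeP _ _ dF.
by rewrite mlabel_flat ?(in_degree_neqT dF).
Qed.

Lemma path_hyp_rank T c i : path hyp T c -> (i < size c)%N ->
  rk T = (rk (nth set0 c i) + i.+1)%N.
Proof.
elim: c T i => //= H c IH T [|i] /andP[hH p] lt; rewrite (hyp_rank hH) ?addn1 //.
by rewrite (IH H i) // !addnS.
Qed.

Lemma path_hyp_last T c : path hyp T c -> rk T = (rk (last T c) + size c)%N.
Proof.
elim: c T => [|H c IH] T /=; first by rewrite addn0.
by case/andP=> hH /IH E; rewrite (hyp_rank hH) E addnS.
Qed.

Definition descent T H := flat M H && (H \proper T).

Lemma path_descent_rank F T c : path descent T c -> flat M F -> F \proper last T c ->
  (rk F + size c < rk T)%N.
Proof.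
move=> + fF; elim: c T => [|H c IH] T /=; first by rewrite addn0 => _ /(mrank_proper fF).
case/andP=> /andP[fH pH] p l; have := IH H p l; have := mrank_proper fH pH.
by rewrite addnS => ? ?; apply: leq_ltn_trans (mrank_proper fH pH).
Qed.

(** Every step lowers the rank by at least one, and the total drop leaves room for no more, so every
    step is a covering. *)
Lemma path_descent_hyp F T c : path descent T c -> flat M F -> F \proper last T c ->
  rk T = (rk F + (size c).+1)%N -> path hyp T c.
Proof.
move=> + fF; elim: c T => //= H c IH T /andP[/andP[fH pH] p] l E.
have := path_descent_rank p fF l; have := mrank_proper fH pH; rewrite E => l1 l2.
have rH : rk H = (rk F + (size c).+1)%N by move: l1 l2; clear; lia.
by rewrite IH // /hyperplane_of fH pH E rH addnS eqxx.
Qed.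

Lemma path_hyp_all T c : path hyp T c ->
  all (fun G => [&& flat M G, G \proper T & last T c \subset G]) c.
Proof.
elim: c T => //= H c IH T /andP[hH p]; have := IH H p.
rewrite (hyp_flat hH) (hyp_proper hH) /= => a.
rewrite (path_hyp_sub p) /=.
apply: sub_all a => G /and3P[-> pG ->]; rewrite andbT /=.
exact: proper_trans pG (hyp_proper hH).
Qed.

End FlatPoset.

(** * Simplicial cycles of the order complexes *)

Section Chains.
Variables (T : finType) (A : nmodType).

(** Extension by zero to lists of every length, so that insertions and reversals can be written on
    lists rather than on tuples. *)
Definition seqfun d (z : {ffun d.-tuple T -> A}) (c : seq T) : A :=
  if insub c is Some t then z t else 0.

Lemma seqfunE d (z : {ffun d.-tuple T -> A}) t : seqfun z (tval t) = z t.
Proof. by rewrite /seqfun valK. Qed.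

Lemma seqfun_size d (z : {ffun d.-tuple T -> A}) c : size c != d -> seqfun z c = 0.
Proof. by move=> sc; rewrite /seqfun insubN. Qed.

Lemma seqfun_neq0 d (z : {ffun d.-tuple T -> A}) c : seqfun z c != 0 ->
  exists2 t : d.-tuple T, tval t = c & z t != 0.
Proof. by rewrite /seqfun; case: insubP => [t _ <- nz|]; [exists t | rewrite eqxx]. Qed.

Lemma seqfun0 d c : seqfun (0 : {ffun d.-tuple T -> A}) c = 0.
Proof. by rewrite /seqfun; case: insubP => // t _ _; rewrite ffunE. Qed.

Lemma face_val d (j : 'I_d.+1) (t : d.+1.-tuple T) :
  tval (face j t) = take j t ++ drop j.+1 t.
Proof.
have x0 : T by exact: thead t.
have jd : (j <= d)%N by rewrite -ltnS.
apply: (@eq_from_nth _ x0) => [|i].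
  by rewrite size_tuple size_cat size_takel ?size_tuple ?size_drop ?size_tuple 1?ltnW //; lia.
rewrite size_tuple => lt; rewrite -[i]/(nat_of_ord (Ordinal lt)) -tnth_nth tnth_mktuple.
rewrite (tnth_nth x0) nth_cat size_takel ?size_tuple ?(leqW jd) //= /bump.
case: (ltnP i j) => [lij|leji]; first by rewrite nth_take.
by rewrite nth_drop; congr nth; lia.
Qed.

(** A tuple with [j]-th face [s] is [s] with one entry inserted at position [j]. Reindexing by that
    entry gives the list form of the face equations in [cyc]. *)
Lemma sum_face d (j : 'I_d.+1) (z : {ffun d.+1.-tuple T -> A}) (s : d.-tuple T) :
  \sum_(t | face j t == s) z t = \sum_C seqfun z (take j s ++ C :: drop j s).
Proof.
have jd : (j <= d)%N by rewrite -ltnS.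
have sz C : size (take j s ++ C :: drop j s) == d.+1.
  by rewrite size_cat /= size_takel ?size_drop ?size_tuple //; apply/eqP; lia.
pose h C : d.+1.-tuple T := Tuple (sz C).
rewrite (reindex_onto h (fun t => tnth t j)) /= => [|t /eqP E].
  apply: eq_big => [C|C _]; last by rewrite -(seqfunE z).
  have -> : tnth (h C) j = C.
    by rewrite (tnth_nth C) /= nth_cat size_takel ?size_tuple // ltnn subnn.
  rewrite eqxx andbT; apply/eqP/val_inj; rewrite /= face_val /=.
  have sj : size (take j s) = j by rewrite size_takel ?size_tuple.
  by rewrite take_size_cat // -cat_rcons drop_size_cat ?size_rcons ?sj // cat_take_drop.
apply/val_inj; rewrite /= -E face_val.
have sj : size (take j t) = j by rewrite size_takel ?size_tuple 1?ltnW.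
rewrite take_size_cat // drop_size_cat // -[RHS](cat_take_drop j); congr (_ ++ _).
by rewrite [RHS](drop_nth (tnth t j)) ?size_tuple // -tnth_nth.
Qed.

Lemma seqfun_insert d (z : {ffun d.+1.-tuple T -> A}) s1 s2 :
    (size s1 + size s2)%N = d ->
  exists (j : 'I_d.+1) (s : d.-tuple T),
    \sum_(t | face j t == s) z t = \sum_C seqfun z (s1 ++ C :: s2).
Proof.
move=> E; have lt : (size s1 < d.+1)%N by rewrite -E ltnS leq_addr.
have sz : size (s1 ++ s2) == d by rewrite size_cat E.
exists (Ordinal lt), (Tuple sz); rewrite sum_face; apply: eq_bigr => C _.
by rewrite /= take_size_cat // drop_size_cat.
Qed.

End Chains.

Section Phi.
Variables (n : nat) (A : zmodType).

Lemma phiE (F : {set 'I_n}) d (u : {ffun d.+1.-tuple {set 'I_n} -> A}) s :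
  phi F u s = u (cons_tuple F s).
Proof.
rewrite ffunE (big_pred1 (cons_tuple F s)) // => t.
case/tupleP: t => H t; rewrite theadE.
have -> : behead_tuple [tuple of H :: t] = t by apply: val_inj.
apply/andP/eqP => [[/eqP-> /eqP-> //]|/(congr1 val) /= [-> /val_inj->]].
by rewrite !eqxx.
Qed.

End Phi.

(** * Simplicial cycles as cycles on saturated flags *)

Section CycleBridge.
Variables (n : nat) (k : fieldType) (M : matroid n).
Implicit Types (C D F G H T : {set 'I_n}) (d : nat).
Local Notation rk := (mrank M).
Local Notation hyp := (hyperplane_of M).

(** Since [F] has corank [d.+1], a chain of [d] flats strictly between [F] and [setT] meets every
    intermediate rank. The list is reversed because a simplex starts at the flat nearest to [F],
    whereas [hyp] paths descend from [setT]. *)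
Lemma simplex_hyp d F (t : d.-tuple {set 'I_n}) : in_degree M d F ->
  simplex M F t = (path hyp setT (rev t)) && (F \subset last setT (rev t)).
Proof.
move=> dF; have [fF rF] := in_degreeP _ _ _ dF.
apply/andP/andP => [[a st]|[p l]].
  have srt : sorted (fun G G' => G' \proper G) (rev t) by rewrite rev_sorted.
  have pd : path (descent M) setT (rev t).
    rewrite path_min_sorted; last first.
      by rewrite all_rev; apply: sub_all a => G /and3P[fG pG _]; rewrite /descent fG.
    apply: sub_in_sorted srt; last by rewrite all_rev; exact: a.
    by move=> x y _ /and3P[fy _ _] pxy; rewrite /descent fy.
  have pl : F \proper last setT (rev t).
    case/lastP: (rev t) (all_rev (fun G => [&& flat M G, ltPf setT G & ltPf G F]) t) => [_|s x].
      by rewrite properT (in_degree_neqT dF).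
    by rewrite a last_rcons all_rcons => /andP[/and3P[]].
  rewrite (path_descent_hyp pd fF pl) ?(proper_sub pl) //.
  by rewrite size_rev size_tuple.
have pl : F \proper last setT (rev t).
  rewrite properEneq l andbT; apply/eqP => E.
  have := path_hyp_last p; rewrite -E size_rev size_tuple rF => /addnI.
  by move/eqP; rewrite -[d in _ == d]addn0 -addn1 eqn_add2l.
split.
  rewrite -all_rev; apply: sub_all (path_hyp_all p) => G /and3P[-> pG lG].
  by rewrite /ltPf pG /=; apply: proper_sub_trans lG.
have := path_sorted p; rewrite rev_sorted; apply: sub_sorted => x y.
exact: hyp_proper.
Qed.

(* A saturated flag determines the rank missing from each of its faces. *)
Lemma face_saturated_inj d F (t t' : d.+1.-tuple {set 'I_n}) (j j' : 'I_d.+1) :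
  in_degree M d.+1 F -> simplex M F t -> simplex M F t' ->
  face j t = face j' t' -> j = j'.
Proof.
move=> dF; rewrite !simplex_hyp // => /andP[p _] /andP[p' _] E.
have rkt (s : d.+1.-tuple {set 'I_n}) (i : 'I_d.+1) : path hyp setT (rev s) ->
    rk setT = (rk (tnth s i) + (d - i).+1)%N.
  move=> ps; rewrite (path_hyp_rank (i := d - i) ps); last first.
    by rewrite size_rev size_tuple ltnS leq_subr.
  rewrite nth_rev size_tuple ?ltnS ?leq_subr // subSS subKn; last by rewrite -ltnS.
  by rewrite (tnth_nth set0).
apply/eqP; apply: contraT => ne.
(* The entry of [t] at position [j'] survives in its [j]-th face, but the [j']-th face of [t'] has
   no flat of that rank. *)
have [i Ei] := unlift_some ne => _.
have /(congr1 rk) := congr1 (fun s => tnth s i) E; rewrite !tnth_mktuple => Er.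
have := rkt t (lift j i) p; rewrite (rkt t' (lift j' i) p') Er => /addnI/succn_inj Es.
have l1 := ltn_ord (lift j i); have l2 := ltn_ord (lift j' i).
have : lift j' i = lift j i :> nat by move: l1 l2 Es; clear; lia.
by rewrite -Ei => /val_inj/esym/eqP; rewrite (negbTE (neq_lift _ _)).
Qed.

Lemma boundaryE d (z : {ffun d.+1.-tuple {set 'I_n} -> k}) s :
  boundary z s = \sum_(j < d.+1) (-1) ^+ j * \sum_(t | face j t == s) z t.
Proof.
rewrite ffunE (exchange_big_dep predT) //=; apply: eq_bigr => j _.
by rewrite mulr_sumr.
Qed.

(** If some simplex over [s] has a nonzero coefficient, [face_saturated_inj] leaves [j] as the only
    position contributing to the boundary at [s], and its sign is invertible. *)
Lemma cycle_face d F (z : {ffun d.+1.-tuple {set 'I_n} -> k}) j s :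
  in_degree M d.+1 F -> is_cycle M F z -> \sum_(t | face j t == s) z t = 0.
Proof.
move=> dF [supp /= /ffunP/(_ s)].
have [/exists_inP[t /eqP ft nz]|] := boolP [exists (t | face j t == s), z t != 0]; last first.
  rewrite negb_exists_in => /forall_inP z0 _; apply: big1 => t /z0.
  by rewrite negbK => /eqP.
rewrite boundaryE ffunE (bigD1 j) //= [X in _ + X]big1 ?addr0 => [/eqP|j' nj'].
  by rewrite mulf_eq0 signr_eq0 => /eqP.
rewrite big1 ?mulr0 // => t' /eqP ft'; apply/eqP; apply: contraNT nj' => nz'.
apply/eqP; apply: (face_saturated_inj dF (supp _ nz') (supp _ nz)).
by rewrite ft ft'.
Qed.

(** The boundary equation splits into separate face equations by [cycle_face]; conversely, these add
    up, with signs, to the boundary equation. *)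
Lemma is_cycle_cyc d F (z : {ffun d.-tuple {set 'I_n} -> k}) : in_degree M d F ->
  is_cycle M F z <-> cyc M F setT d (fun c => seqfun z (rev c)).
Proof.
move=> dF; split=> [cz|[supp fc]]; split.
- move=> c /seqfun_neq0[t tE nz]; have := cz.1 t nz; rewrite simplex_hyp // tE revK.
  by case/andP=> p l; split=> //; rewrite -size_rev -tE size_tuple.
- case: d z dF cz => // d z dF cz s1 s2 [E].
  under eq_bigr => C _ do rewrite rev_cat rev_cons cat_rcons.
  have [|j [s <-]] := @seqfun_insert _ _ d z (rev s2) (rev s1).
    by rewrite !size_rev addnC.
  exact: (cycle_face j s dF cz).
- move=> t nz; rewrite simplex_hyp //.
  by have [|_ -> ->] := supp (rev t); rewrite ?revK ?seqfunE.
- case: d z dF supp fc => // d z dF supp fc /=; apply/ffunP => s.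
  rewrite boundaryE ffunE big1 // => j _; rewrite sum_face.
  have := fc (rev (drop j s)) (rev (take j s)).
  rewrite !size_rev size_drop size_takel ?size_tuple; last by rewrite -ltnS.
  rewrite subnK; last by rewrite -ltnS.
  move=> /(_ erefl) h; apply/eqP; rewrite mulf_eq0; apply/orP; right.
  apply/eqP; apply: etrans h; apply: eq_bigr => C _.
  by rewrite rev_cat rev_cons !revK cat_rcons.
Qed.

Lemma is_cycle0 d F : is_cycle M F (0 : {ffun d.-tuple {set 'I_n} -> k}).
Proof.
split=> [t|]; first by rewrite ffunE eqxx.
case: d => //= d; apply/ffunP => s; rewrite boundaryE ffunE big1 // => j _.
by rewrite big1 ?mulr0 // => t _; rewrite ffunE.
Qed.

Lemma cycle_thead d F H (z : {ffun d.+1.-tuple {set 'I_n} -> k}) s :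
    in_degree M d.+1 F -> is_cycle M F z -> z (cons_tuple H s) != 0 ->
  in_degree M d H /\ F \proper H.
Proof.
move=> dF cz nz; have := cz.1 _ nz; rewrite simplex_hyp // => /andP[].
rewrite /= rev_cons last_rcons -cats1 cat_path /= andbT => /andP[p hH] FH.
have fH := hyp_flat hH; have [fF rF] := in_degreeP _ _ _ dF.
have := path_hyp_last p; rewrite size_rev size_tuple (hyp_rank hH) => rH.
split; first by apply/in_degreeP; rewrite rH addSnnS.
rewrite properEneq FH andbT; apply/eqP => E; move: rF; rewrite E rH; clear; lia.
Qed.

Lemma cycle_phi d F F' (z : {ffun d.+1.-tuple {set 'I_n} -> k}) :
  in_degree M d.+1 F -> in_degree M d F' -> is_cycle M F z -> is_cycle M F' (phi F' z).
Proof.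
move=> dF dF' cz; apply/(is_cycle_cyc _ dF').
have [supp fc] := (is_cycle_cyc z dF).1 cz.
(* Read from the ground set down, [phi F'] keeps the flags ending in [F'] and removes that last
   flat. *)
have E c : seqfun (phi F' z) (rev c) = seqfun z (rev (rcons c F')).
  rewrite rev_rcons; have [sc|sc] := boolP (size (rev c) == d).
    rewrite -[rev c]/(tval (Tuple sc)) seqfunE phiE -(seqfunE z).
    by [].
  by rewrite !seqfun_size.
split=> [c|s1 s2 ss].
  rewrite E => /supp[]; rewrite size_rcons last_rcons -cats1 cat_path /= andbT.
  by move=> [sc] /andP[p hF'] _; split=> //; exact: hyp_sub hF'.
have := fc s1 (rcons s2 F'); rewrite size_rcons addnS ss => /(_ erefl) h.
by apply: etrans h; apply: eq_bigr => C _; rewrite E -rcons_cons -rcons_cat.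
Qed.

(** This equation makes the differential square to zero: the sum over the intermediate flat is a sum
    over the first entry. *)
Lemma cycle_first_face d F s (z : {ffun d.+1.-tuple {set 'I_n} -> k}) :
  in_degree M d.+1 F -> is_cycle M F z -> \sum_C z (cons_tuple C s) = 0.
Proof.
move=> dF /(cycle_face ord0 s dF); rewrite sum_face take0 drop0 => h.
by apply: etrans h; apply: eq_bigr => C _; rewrite -(seqfunE z).
Qed.

(** Appending [F] to the flags of [z F] glues the family into one function on flags of length
    [d.+1]. The faces missing the last flat vanish by the hypothesis on sums, the others because
    each [z F] is a cycle; a decomposition of the glued cycle is the required [y]. *)
Lemma strand_exact d G (z : {set 'I_n} -> {ffun d.-tuple {set 'I_n} -> k}) :
    flat M G -> (forall F, z F != 0 -> in_degree M d F && (G \subset F)) ->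
    (forall F, is_cycle M F (z F)) -> (forall c, \sum_F seqfun (z F) c = 0) ->
  exists y : {set 'I_n} -> {ffun d.+1.-tuple {set 'I_n} -> k},
    [/\ forall F, y F != 0 -> in_degree M d.+1 F && (G \subset F),
        forall F, is_cycle M F (y F)
      & forall F s, z F s = \sum_F' y F' (cons_tuple F s)].
Proof.
move=> fG zP cz zs.
(* If [G] has corank at most [d.+1], only [F = G] can occur, and the vanishing sums force
   [z G = 0]. *)
have [lt|ge] := ltnP (rk G + d.+1) (rk setT); last first.
  suff z0 F : z F = 0.
    exists (fun=> 0); split=> [F|F|F s]; rewrite ?eqxx //; first exact: is_cycle0.
    by rewrite z0 big1 ?ffunE // => F' _; rewrite ffunE.
  have zG F' : F' != G -> z F' = 0.
    move=> nF'; apply/eqP; apply: contraNT nF' => /zP/andP[/in_degreeP[fF' r] GF'].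
    by rewrite eq_sym; apply/eqP/(flat_eq fG) => //; move: ge; rewrite r leq_add2r.
  have [->|/zG //] := eqVneq F G; apply/ffunP => t; rewrite ffunE -(seqfunE (z G)).
  by have := zs t; rewrite (bigD1 G) //= big1 ?addr0 // => F' /zG->; rewrite seqfun0.
pose Z c : k := if rev c is F :: s then seqfun (z F) s else 0.
have cZ : cyc M G setT d.+1 Z.
  split=> [c|s1 s2].
    case/lastP: c => [|c F]; rewrite /Z ?eqxx // rev_rcons => nz.
    have zF : z F != 0.
      by apply: contraNneq nz => ->; rewrite seqfun0.
    have /andP[dF GF] := zP F zF; have [fF rF] := in_degreeP _ _ _ dF.
    have [sc p l] := cyc_supp ((is_cycle_cyc _ dF).1 (cz F)) nz.
    rewrite size_rcons sc last_rcons -cats1 cat_path p /= andbT; split=> //.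
    have := path_hyp_last p; rewrite sc rF addnS -addSn => /addIn rl.
    rewrite /hyperplane_of fF -rl eqxx andbT properEneq l andbT; apply/eqP => E.
    by move: rl; rewrite -E => /esym/n_Sn.
  case/lastP: s2 => [|s2 F] /= E.
    under eq_bigr => C _ do rewrite /Z cats1 rev_rcons.
    exact: zs.
  under eq_bigr => C _ do rewrite /Z -rcons_cons -rcons_cat rev_rcons.
  have [z0|zF] := eqVneq (z F) 0; first by rewrite big1 // => C _; rewrite z0 seqfun0.
  have /andP[dF GF] := zP F zF.
  apply: (cyc_face ((is_cycle_cyc _ dF).1 (cz F))).
  by move: E; rewrite size_rcons addnS => -[].
have [y [yP cy yE]] := cyc_decomposable (flatT M) fG (subsetT G) lt cZ.
exists (fun F => [ffun t : d.+1.-tuple _ => y F (rev t)]).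
have dP F : [ffun t : d.+1.-tuple _ => y F (rev t)] != 0 -> in_degree M d.+1 F && (G \subset F).
  move=> nz; have [t] : exists t : d.+1.-tuple {set 'I_n}, y F (rev t) != 0.
    apply/existsP; apply: contraNT nz; rewrite negb_exists => /forallP h.
    by apply/eqP/ffunP => t; rewrite !ffunE; apply/eqP; rewrite -[_ == _]negbK h.
  by move=> /yP[fF GF _ r]; rewrite GF andbT; apply/in_degreeP.
split=> [//|F|F s].
  have [->|/dP/andP[dF _]] := eqVneq [ffun t : d.+1.-tuple _ => y F (rev t)] 0.
    exact: is_cycle0.
  apply/(is_cycle_cyc _ dF); apply: cyc_ext (cy F) => c.
  have [sc|sc] := boolP (size (rev c) == d.+1).
    by rewrite -[rev c]/(tval (Tuple sc)) seqfunE ffunE revK.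
  rewrite seqfun_size //; apply/eqP; apply: contraNT sc => /(cyc_supp (cy F))[sc _ _].
  by rewrite size_rev sc.
have := yE (rev (F :: s)); rewrite /Z revK seqfunE => ->.
by apply: eq_bigr => F' _; rewrite ffunE.
Qed.

End CycleBridge.

(** * Multigraded strands of the complex *)

Lemma mcoeffMX_le (n : nat) (k : fieldType) (p : {mpoly k[n]}) (m a : 'X_{1..n}) :
  (p * 'X_[m])@_a != 0 -> (m <= a)%MM.
Proof.
apply: contraNT => ma; rewrite mcoeffM big1 // => -[m1 m2] /= /eqP E.
rewrite mcoeffX; have [mE|_] := eqVneq m m2; last by rewrite mulr0.
by rewrite E mE lem_addl in ma.
Qed.

(** * Linear algebra of the spaces of cycles *)

Section CycleSpaces.
Variables (n : nat) (k : fieldType) (M : matroid n).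
Implicit Types (F G H : {set 'I_n}) (d : nat).

Lemma is_cycle_comb (I : finType) d F (c : I -> k)
    (z : I -> {ffun d.-tuple {set 'I_n} -> k}) :
  (forall i, is_cycle M F (z i)) -> is_cycle M F [ffun t => \sum_i c i * z i t].
Proof.
move=> cz; split=> [t|].
  rewrite ffunE; have [/existsP[i nz _]|] := boolP [exists i, z i t != 0].
    exact: (cz i).1 nz.
  rewrite negb_exists => /forallP z0; rewrite big1 ?eqxx // => i _.
  by have := z0 i; rewrite negbK => /eqP->; rewrite mulr0.
case: d z cz => //= d z cz; apply/ffunP => s; rewrite boundaryE ffunE.
transitivity (\sum_i c i * boundary (z i) s); last first.
  by apply: big1 => i _; have [_ /= ->] := cz i; rewrite ffunE mulr0.
under [RHS]eq_bigr => i _ do rewrite boundaryE mulr_sumr.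
rewrite exchange_big /=; apply: eq_bigr => j _.
under [X in _ * X = _]eq_bigr => t _ do rewrite ffunE.
rewrite exchange_big mulr_sumr /=; apply: eq_bigr => i _.
by rewrite -mulr_sumr mulrCA.
Qed.

Lemma kernel_basis (X I : finType) (m : I -> X -> k) :
  exists (r : nat) (b : 'I_r -> {ffun X -> k}),
    [/\ forall i j, \sum_t m j t * b i t = 0,
        forall z : {ffun X -> k}, (forall j, \sum_t m j t * z t = 0) ->
          exists c : 'I_r -> k, forall t, z t = \sum_i c i * b i t
      & forall c : 'I_r -> k, (forall t, \sum_i c i * b i t = 0) ->
          forall i, c i = 0].
Proof.
pose f (z : {ffun X -> k^o}) : {ffun I -> k^o} := [ffun j => \sum_t m j t * z t].
have lin_f : linear f.
  move=> a u v; apply/ffunP => j; rewrite !ffunE scaler_sumr -big_split.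
  by apply: eq_bigr => t _; rewrite !ffunE mulrDr; congr (_ + _); exact: mulrCA.
pose fL := GRing.isLinear.Build k {ffun X -> k^o} {ffun I -> k^o} _ f lin_f.
pose g : {linear {ffun X -> k^o} -> {ffun I -> k^o}} := HB.pack f fL.
pose K := lker (linfun g).
have KP (z : {ffun X -> k^o}) : reflect (forall j, \sum_t m j t * z t = 0) (z \in K).
  rewrite memv_ker lfunE /=; apply: (iffP eqP) => [/ffunP h j|h].
    by have := h j; rewrite !ffunE.
  by apply/ffunP => j; rewrite !ffunE h.
have combE (c : 'I_(\dim K) -> k) t :
    (\sum_i c i *: (vbasis K)`_i) t = \sum_i c i * (vbasis K)`_i t.
  by rewrite sum_ffunE; apply: eq_bigr => i _; rewrite ffunE.
exists (\dim K), (fun i => (vbasis K)`_i); split.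
- by move=> i; apply/KP; rewrite vbasis_mem // mem_nth // size_tuple.
- move=> z /KP/coord_vbasis zE; exists (fun i => coord (vbasis K) i z) => t.
  by rewrite {1}zE combE.
- move=> c c0; have /freeP := basis_free (vbasisP K); apply.
  by apply/ffunP => t; rewrite combE c0 ffunE.
Qed.

(** Both conditions are linear: each tuple that is not a simplex gives an equation killing its
    coefficient, and each face gives a boundary equation. A sum type indexes the two families
    together. *)
Lemma cycle_kernel d F : exists (I : finType) (m : I -> d.-tuple {set 'I_n} -> k),
  forall z, is_cycle M F z <-> forall j, \sum_t m j t * z t = 0.
Proof.
have suppE (z : {ffun d.-tuple {set 'I_n} -> k}) :
    (forall t, z t != 0 -> simplex M F t) <->
    forall s, \sum_t (~~ simplex M F s && (t == s))%:R * z t = 0.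
  split=> h t.
    rewrite (bigD1 t) //= eqxx andbT big1 ?addr0 => [|s /negbTE->].
      have [->|/h->] := eqVneq (z t) 0; rewrite ?mulr0 ?mul0r //.
    by rewrite andbF mul0r.
  have := h t; rewrite (bigD1 t) //= eqxx andbT big1 ?addr0 => [|s /negbTE->].
    by case: (simplex M F t) => //=; rewrite mul1r => ->; rewrite eqxx.
  by rewrite andbF mul0r.
case: d suppE => [|d] suppE.
  exists _, (fun s t => (~~ simplex M F s && (t == s))%:R) => z; rewrite -suppE.
  by split=> [[]|].
exists (d.+1.-tuple {set 'I_n} + d.-tuple {set 'I_n})%type.
exists (fun i t => match i with
  | inl s => (~~ simplex M F s && (t == s))%:R
  | inr s => \sum_(j < d.+1 | face j t == s) (-1) ^+ j end) => z.
have bE s : boundary z s = \sum_t (\sum_(j < d.+1 | face j t == s) (-1) ^+ j) * z t.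
  by rewrite ffunE; apply: eq_bigr => t _; rewrite mulr_suml.
split=> [[/suppE zs /= /ffunP b0] [s|s] //|h].
  by rewrite -bE b0 ffunE.
split; first by apply/suppE => s; exact: (h (inl s)).
by apply/ffunP => s; rewrite bE ffunE; exact: (h (inr s)).
Qed.

Lemma cycle_basis d F :
  exists (r : nat) (b : 'I_r -> {ffun d.-tuple {set 'I_n} -> k}),
    [/\ forall i, is_cycle M F (b i),
        forall z, is_cycle M F z ->
          exists c : 'I_r -> k, forall t, z t = \sum_i c i * b i t
      & forall c : 'I_r -> k, (forall t, \sum_i c i * b i t = 0) ->
          forall i, c i = 0].
Proof.
have [I [m mP]] := cycle_kernel d F; have [r [b [bK bS bI]]] := kernel_basis m.
by exists r, b; split=> // [i|z /mP/bS//]; apply/mP.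
Qed.

End CycleSpaces.

(** * Homogeneous components and exactness of the complex *)

Section Strands.
Variables (n : nat) (k : fieldType) (M : matroid n).
Implicit Types (F G H : {set 'I_n}) (d : nat) (a : 'X_{1..n}).

Definition tcoef d a (u : {ffun d.-tuple {set 'I_n} -> {mpoly k[n]}^o}) :
    {ffun d.-tuple {set 'I_n} -> k} := [ffun t => (u t : {mpoly k[n]})@_a].

Lemma in_summandI (I : finType) d F
    (u : {ffun d.-tuple {set 'I_n} -> {mpoly k[n]}^o}) (z : I -> {ffun d.-tuple {set 'I_n} -> k})
    (f : I -> {mpoly k[n]}) :
  (forall i, is_cycle M F (z i)) -> (forall i, in_principal (mlabel M F) (f i)) ->
  (forall t, u t = \sum_i (z i t)%:MP * f i) -> in_summand M F u.
Proof.
move=> cz pf uE; exists #|I|, (fun i => z (enum_val i)), (fun i => f (enum_val i)).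
by split=> // t; rewrite uE -(big_enum_val (fun i => (z i t)%:MP * f i)).
Qed.

(** Cycles form a [k]-space, so each coefficient of a tensor is again a cycle; conversely [u] is the
    sum of its coefficient cycles tensored with monomials. *)
Lemma in_summandP d F (u : {ffun d.-tuple {set 'I_n} -> {mpoly k[n]}^o}) :
  in_summand M F u <->
  forall a, is_cycle M F (tcoef a u) /\ (tcoef a u != 0 -> (mlabel M F <= a)%MM).
Proof.
split=> [[r [z [f [cz pf uE]]]] a|h].
  have E : tcoef a u = [ffun t => \sum_i (f i)@_a * z i t].
    apply/ffunP => t; rewrite !ffunE uE raddf_sum; apply: eq_bigr => i _ /=.
    by rewrite mcoeffCM mulrC.
  split; first by rewrite E; apply: is_cycle_comb.
  apply: contraNT => ma; rewrite E; apply/eqP/ffunP => t; rewrite !ffunE big1 // => i _.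
  have [g ->] := pf i; suff -> : (g * 'X_[mlabel M F])@_a = 0 by rewrite mul0r.
  by apply/eqP; apply: contraNT ma => /mcoeffMX_le.
(* The bound [b] makes the set of multidegrees finite. The second factor below is set to 0 where
   ['X_[a]] is outside the ideal; the coefficient cycle is zero there. *)
pose b := \max_t msize (u t : {mpoly k[n]}).
apply: (@in_summandI 'X_{1..n < b} _ _ _ (fun a : 'X_{1..n < b} => tcoef a u)
  (fun a : 'X_{1..n < b} => if (mlabel M F <= a)%MM then 'X_[a] else 0)) => [a|a|t].
- exact: (h a).1.
- case: ifP => [le|_]; last by exists 0; rewrite mul0r.
  by exists 'X_[a - mlabel M F]; rewrite -mpolyXD submK.
rewrite {1}(@mpolywE _ _ b (u t)) ?leq_bigmax //; apply: eq_bigr => a _.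
rewrite ffunE mul_mpolyC; case: ifP => // /negbT ma; rewrite scaler0.
have := (h a).2; have [/ffunP/(_ t)|_ /(_ isT)] := eqVneq (tcoef a u) 0.
  by rewrite !ffunE => ->; rewrite scale0r.
by rewrite (negbTE ma).
Qed.

Lemma in_summand_lin d F p (u v : {ffun d.-tuple {set 'I_n} -> {mpoly k[n]}^o}) :
  in_summand M F u -> in_summand M F v -> in_summand M F (p *: u + v).
Proof.
move=> [r1 [z1 [f1 [c1 p1 E1]]]] [r2 [z2 [f2 [c2 p2 E2]]]].
apply: (@in_summandI ('I_r1 + 'I_r2)%type _ _ _
  (fun i => match i with inl j => z1 j | inr j => z2 j end)
  (fun i => match i with inl j => p * f1 j | inr j => f2 j end)) => [[]//|[i|//]|t].
  by have [g ->] := p1 i; exists (p * g); rewrite mulrA.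
rewrite big_sumType /= !ffunE E1 E2; congr (_ + _).
rewrite [LHS]mulr_sumr; apply: eq_bigr => i _; exact: mulrCA.
Qed.

(* The component of multidegree a of the complex, as a complex of k-chains. *)
Definition strand d a (z : {set 'I_n} -> {ffun d.-tuple {set 'I_n} -> k}) : Prop :=
  (forall F, is_cycle M F (z F)) /\
  (forall F, z F != 0 -> in_degree M d F && (mexp F <= a)%MM).

Definition strand_diff d (z : {set 'I_n} -> {ffun d.+1.-tuple {set 'I_n} -> k})
    (F : {set 'I_n}) : {ffun d.-tuple {set 'I_n} -> k} :=
  [ffun s => \sum_F' z F' (cons_tuple F s)].

Definition monomial_part d a (z : {set 'I_n} -> {ffun d.-tuple {set 'I_n} -> k}) :
    CPambient n k d := [ffun F => [ffun t => (z F t)%:MP * 'X_[a]]].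

Lemma monomial_partE d a (z : {set 'I_n} -> {ffun d.-tuple {set 'I_n} -> k}) F t :
  monomial_part a z F t = (z F t)%:MP * 'X_[a].
Proof. by rewrite !ffunE. Qed.

Lemma tcoef_monomial_part d a b (z : {set 'I_n} -> {ffun d.-tuple {set 'I_n} -> k}) F :
  tcoef b (monomial_part a z F) = if a == b then z F else 0.
Proof.
apply/ffunP => t; rewrite ffunE monomial_partE mcoeffCM mcoeffX.
by case: eqP; rewrite ?mulr1 ?mulr0 ?ffunE.
Qed.

Lemma CPmemP d (u : CPambient n k d) :
  CPmem M u <-> forall a, strand a (fun F => tcoef a (u F)).
Proof.
split=> [mu a|h F].
  split=> F; have := mu F; case: (boolP (in_degree M d F)) => [dF|_].
  - by move=> /in_summandP/(_ a)[].
  - move=> ->; have -> : tcoef a (0 : {ffun d.-tuple {set 'I_n} -> {mpoly k[n]}^o}) = 0.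
      by apply/ffunP => t; rewrite !ffunE mcoeff0.
    exact: is_cycle0.
  - by move=> /in_summandP/(_ a)[_]; rewrite (mlabel_degree dF).
  - by move=> ->; apply: contraNT => _; apply/eqP/ffunP => t; rewrite !ffunE mcoeff0.
case: (boolP (in_degree M d F)) => [dF|nF].
  apply/in_summandP => a; have [cz zP] := h a; split=> // /zP/andP[_].
  by rewrite (mlabel_degree dF).
apply/ffunP => t; rewrite ffunE; apply/mpolyP => a; rewrite mcoeff0.
have [_ /(_ F)] := h a; rewrite (negbTE nF).
have [/ffunP/(_ t)|_ /(_ isT)//] := eqVneq (tcoef a (u F)) 0.
by rewrite !ffunE.
Qed.

Lemma strand_mem d a (z : {set 'I_n} -> {ffun d.-tuple {set 'I_n} -> k}) :
  strand a z -> CPmem M (monomial_part a z).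
Proof.
move=> sz; apply/CPmemP => b; have [<-|ne] := eqVneq a b.
  by case: sz => cz zP; split=> F; rewrite tcoef_monomial_part eqxx; [apply: cz | apply: zP].
by split=> F; rewrite tcoef_monomial_part (negbTE ne) ?eqxx //; apply: is_cycle0.
Qed.

Lemma CPmem_out d (u : CPambient n k d) F : CPmem M u -> ~~ in_degree M d F -> u F = 0.
Proof. by move=> /(_ F) + /negbTE nF; rewrite nF. Qed.

Lemma CPmem0 d : CPmem M (0 : CPambient n k d).
Proof.
apply/CPmemP => a; split=> F; rewrite (_ : tcoef _ _ = 0) ?eqxx //.
- exact: is_cycle0.
- by apply/ffunP => t; rewrite !ffunE mcoeff0.
- by apply/ffunP => t; rewrite !ffunE mcoeff0.
Qed.

Lemma CPmem_lin d p (u v : CPambient n k d) :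
  CPmem M u -> CPmem M v -> CPmem M (p *: u + v).
Proof.
move=> mu mv F; have := mu F; have := mv F; rewrite !ffunE; case: ifP => _.
  by move=> mF uF; apply: in_summand_lin.
by move=> -> ->; rewrite scaler0 addr0.
Qed.

Lemma CPmem_sum (I : finType) d (u : I -> CPambient n k d) :
  (forall i, CPmem M (u i)) -> CPmem M (\sum_i u i).
Proof.
move=> mu; apply: (big_ind (fun v => CPmem M v)) => // [|v w mv mw].
  exact: CPmem0.
by rewrite -[v]scale1r; apply: CPmem_lin.
Qed.

Lemma monomial_decomp d (u : CPambient n k d) : exists b : nat,
  u = \sum_(a : 'X_{1..n < b}) monomial_part a (fun F => tcoef a (u F)).
Proof.
exists (\max_F \max_t msize (u F t : {mpoly k[n]})).
apply/ffunP => F; apply/ffunP => t; rewrite sum_ffunE sum_ffunE.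
rewrite {1}(@mpolywE _ _ (\max_F \max_t msize (u F t : {mpoly k[n]})) (u F t)); last first.
  apply: leq_trans (leq_bigmax F).
  exact: (leq_bigmax (F := fun t => msize (u F t : {mpoly k[n]}))).
by apply: eq_bigr => a _; rewrite monomial_partE ffunE mul_mpolyC.
Qed.

Lemma CPhomogP d a (u : CPambient n k d) : CPhomog M a u ->
  exists2 z, strand a z & u = monomial_part a z.
Proof.
case=> mu uX; exists (fun F => tcoef a (u F)); first exact: (CPmemP _).1.
apply/ffunP => F; apply/ffunP => t; rewrite monomial_partE ffunE.
by have [c ->] := uX F t; rewrite mcoeffCM mcoeffX eqxx mulr1.
Qed.

Lemma strand_homog d a (z : {set 'I_n} -> {ffun d.-tuple {set 'I_n} -> k}) :
  strand a z -> CPhomog M a (monomial_part a z).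
Proof.
move=> sz; split=> [|F t]; first exact: strand_mem.
by exists (z F t); rewrite monomial_partE.
Qed.

Lemma strand_supp d a (z : {set 'I_n} -> {ffun d.+1.-tuple {set 'I_n} -> k}) F F' s :
    strand a z -> z F' (cons_tuple F s) != 0 ->
  [/\ in_degree M d.+1 F', in_degree M d F, F' \proper F & (mexp F' <= a)%MM].
Proof.
move=> [cz zP] nz; have /zP/andP[dF' le] : z F' != 0.
  by apply: contraNneq nz => ->; rewrite ffunE.
by have [dF pF] := cycle_thead dF' (cz F') nz.
Qed.

Lemma strand_diff_supp d a (z : {set 'I_n} -> {ffun d.+1.-tuple {set 'I_n} -> k}) F :
    strand a z -> strand_diff z F != 0 ->
  exists F', [/\ in_degree M d F, F' \proper F & (mexp F' <= a)%MM].
Proof.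
move=> sz nz; have [/existsP[s /existsP[F' nzs]]|] :=
  boolP [exists s, exists F', z F' (cons_tuple F s) != 0].
  by have [_ ? ? ?] := strand_supp sz nzs; exists F'.
rewrite negb_exists => /forallP h; case/eqP: nz; apply/ffunP => s; rewrite !ffunE.
apply: big1 => F' _; apply/eqP.
by have := h s; rewrite negb_exists => /forallP/(_ F'); rewrite negbK.
Qed.

Lemma mexp_le F a : (mexp F <= a)%MM = ([set i | a i == 0%N] \subset F).
Proof.
apply/mnm_lepP/subsetP => [h i|h i]; last first.
  rewrite mnmE; case: (boolP (i \in F)) => // iF; rewrite lt0n.
  by apply: contra iF => ai; apply: h; rewrite inE.
rewrite inE => /eqP ai; apply: contraT => iF.
by have := h i; rewrite mnmE iF ai.
Qed.

Lemma mexpS F G : F \subset G -> (mexp G <= mexp F)%MM.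
Proof.
move=> FG; rewrite mexp_le; apply/subsetP => i; rewrite inE mnmE.
by case: (boolP (i \in F)) => // iF _; rewrite (subsetP FG).
Qed.

Lemma strand_diff_strand d a (z : {set 'I_n} -> {ffun d.+1.-tuple {set 'I_n} -> k}) :
  strand a z -> strand a (strand_diff z).
Proof.
move=> sz; have [cz zP] := sz; split=> F; last first.
  move=> /(strand_diff_supp sz)[F' [-> /proper_sub/mexpS le leF']] /=.
  exact: lepm_trans leF'.
have [->|/(strand_diff_supp sz)[_ [dF _ _]]] := eqVneq (strand_diff z F) 0.
  exact: is_cycle0.
have -> : strand_diff z F = [ffun s => \sum_F' 1 * phi F (z F') s].
  by apply/ffunP => s; rewrite !ffunE; apply: eq_bigr => F' _; rewrite mul1r phiE.
apply: is_cycle_comb => F'; have [->|/zP/andP[dF' _]] := eqVneq (z F') 0.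
  rewrite (_ : phi _ _ = 0); first exact: is_cycle0.
  by apply/ffunP => s; rewrite phiE !ffunE.
exact: (cycle_phi dF' dF (cz F')).
Qed.

(** Outside the prescribed degrees every term is zero: [u F'] vanishes unless [F'] has degree
    [d.+1], and then its simplices start at flats of degree [d]. *)
Lemma CPdiffE d (u : CPambient n k d.+1) F s : CPmem M u ->
  CPdiff M u F s = \sum_F' u F' (cons_tuple F s).
Proof.
move=> mu; rewrite ffunE; case: ifP => [dF|/negbT nF].
  rewrite sum_ffunE [RHS](bigID (in_degree M d.+1)) /= [X in _ = _ + X]big1 ?addr0.
    by apply: eq_bigr => F' _; rewrite phiE.
  by move=> F' /(CPmem_out mu)->; rewrite ffunE.
rewrite ffunE big1 // => F' _; apply/mpolyP => a; rewrite mcoeff0; apply/eqP.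
have sz := (CPmemP u).1 mu a.
apply: contraNT nF => nz; have [|_ ->] // := strand_supp (F := F) (F' := F') (s := s) sz.
by rewrite ffunE.
Qed.

Lemma tcoef_CPdiff d a (u : CPambient n k d.+1) F : CPmem M u ->
  tcoef a (CPdiff M u F) = strand_diff (fun F' => tcoef a (u F')) F.
Proof.
move=> mu; apply/ffunP => s; rewrite ffunE CPdiffE // raddf_sum ffunE.
by apply: eq_bigr => F' _; rewrite ffunE.
Qed.

Lemma CPdiff_mem d (u : CPambient n k d.+1) : CPmem M u -> CPmem M (CPdiff M u).
Proof.
move=> mu; apply/CPmemP => a; have [c s] := strand_diff_strand ((CPmemP u).1 mu a).
by split=> F; rewrite tcoef_CPdiff //; apply: s.
Qed.

Lemma CPdiff_monomial_part d a (z : {set 'I_n} -> {ffun d.+1.-tuple {set 'I_n} -> k}) :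
  strand a z -> CPdiff M (monomial_part a z) = monomial_part a (strand_diff z).
Proof.
move=> sz; apply/ffunP => F; apply/ffunP => s; rewrite CPdiffE; last exact: strand_mem.
rewrite monomial_partE ffunE raddf_sum mulr_suml; apply: eq_bigr => F' _.
by rewrite monomial_partE.
Qed.

Lemma CPdiff_lin d p (u v : CPambient n k d.+1) :
  CPdiff M (p *: u + v) = p *: CPdiff M u + CPdiff M v.
Proof.
apply/ffunP => F; apply/ffunP => s; rewrite !ffunE; case: ifP => _; last first.
  by rewrite !ffunE scaler0 addr0.
rewrite !sum_ffunE scaler_sumr -big_split; apply: eq_bigr => F' _ /=.
by rewrite !phiE !ffunE.
Qed.

Lemma CPdiff_sum (I : finType) d (u : I -> CPambient n k d.+1) :
  CPdiff M (\sum_i u i) = \sum_i CPdiff M (u i).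
Proof.
apply: (big_morph (@CPdiff n k M d)) => [v w|].
  by rewrite -[v]scale1r CPdiff_lin !scale1r.
have := @CPdiff_lin d (-1) 0 0; rewrite scaler0 addr0 => E.
by rewrite E scaleN1r addNr.
Qed.

Lemma CPmem_first_face d (u : CPambient n k d.+1) F s : CPmem M u ->
  \sum_C u F (cons_tuple C s) = 0.
Proof.
move=> mu; apply/mpolyP => a; rewrite mcoeff0 raddf_sum.
have [cz zP] := (CPmemP u).1 mu a.
have [z0|/zP/andP[dF _]] := eqVneq (tcoef a (u F)) 0.
  by apply: big1 => C _; have /ffunP/(_ (cons_tuple C s)) := z0; rewrite !ffunE.
apply: etrans (cycle_first_face s dF (cz F)).
by apply: eq_bigr => C _; rewrite ffunE.
Qed.

Lemma strand_lift d a (z : {set 'I_n} -> {ffun d.-tuple {set 'I_n} -> k}) :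
    strand a z -> (forall c, \sum_F seqfun (z F) c = 0) ->
  exists y, strand a y /\ forall F, strand_diff y F = z F.
Proof.
(* A flat occurs in multidegree [a] exactly when it contains all [i] with [a i = 0], hence exactly
   when it contains [G]. *)
move=> [cz zP] z0; pose G := mclosure M [set i | a i == 0%N].
have GP d' F : in_degree M d' F -> (G \subset F) = (mexp F <= a)%MM.
  move=> /in_degreeP[fF _]; rewrite mexp_le; apply/idP/idP => [|h].
    by apply: subset_trans; apply: sub_mclosure.
  exact: mclosure_sub.
have [|F /zP/andP[dF le]|y [yP cy yE]] := @strand_exact _ _ M d G z _ _ cz z0.
- exact: flat_mclosure.
- by rewrite dF (GP _ _ dF).
exists y; split; last by move=> F; apply/ffunP => s; rewrite ffunE yE.
by split=> // F /yP/andP[dF]; rewrite dF (GP _ _ dF).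
Qed.

(** The hypothesis covers all degrees at once: for [d = 0] the list [c] that matters is empty and
    the sum is the augmentation; otherwise it is a coefficient of the differential. *)
Lemma CP_exact d (u : CPambient n k d) : CPmem M u ->
    (forall a c, \sum_F seqfun (tcoef a (u F)) c = 0) ->
  exists v, CPmem M v /\ CPdiff M v = u.
Proof.
move=> mu u0; have [b uE] := monomial_decomp u.
have /fin_all_exists[y yP] (a : 'X_{1..n < b}) :=
  strand_lift ((CPmemP u).1 mu a) (u0 a).
exists (\sum_(a : 'X_{1..n < b}) monomial_part a (y a)); split.
  by apply: CPmem_sum => a; apply: strand_mem; case: (yP a).
rewrite CPdiff_sum uE; apply: eq_bigr => a _; have [sy yE] := yP a.
rewrite CPdiff_monomial_part //; apply/ffunP => F; apply/ffunP => t.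
by rewrite !monomial_partE yE.
Qed.

End Strands.

(** * The resolution *)

Section Resolution.
Variables (n : nat) (k : fieldType) (M : matroid n).
Implicit Types (F G H : {set 'I_n}) (d : nat).

Lemma CP_scaleE d (p : {mpoly k[n]}) (u : CPambient n k d) F t :
  (p *: u) F t = p * (u F t : {mpoly k[n]}).
Proof. by rewrite !ffunE. Qed.

Lemma CP_addE d (u v : CPambient n k d) F t : (u + v) F t = u F t + v F t.
Proof. by rewrite !ffunE. Qed.

Lemma CP_graded d : is_graded (CP k M d).
Proof.
split=> /=.
- exact: CPmem0.
- exact: CPmem_lin.
- by move=> a u [].
- move=> a; split=> [|F t]; first exact: CPmem0.
  by exists 0; rewrite !ffunE mpolyC0 mul0r.
- move=> a c u v [mu uX] [mv vX]; split=> [|F t]; first exact: CPmem_lin.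
  have [cu Eu] := uX F t; have [cv Ev] := vX F t; exists (c * cu + cv).
  by rewrite CP_addE CP_scaleE Eu Ev mpolyCD mpolyCM mulrDl mulrA.
- move=> a b u [mu uX]; split=> [|F t].
    by rewrite -['X_[b] *: u]addr0; apply: CPmem_lin => //; apply: CPmem0.
  have [cu Eu] := uX F t; exists cu.
  by rewrite CP_scaleE Eu mpolyXD mulrCA.
- move=> u mu; have [b uE] := monomial_decomp u.
  exists [seq bmnm a | a <- enum {: 'X_{1..n < b}}].
  exists (fun a => monomial_part a (fun F => tcoef a (u F))); split=> [a|].
    by apply: strand_homog; apply: (CPmemP _ _).1.
  by rewrite big_map big_enum.
- move=> s w us wX E a sa; apply/ffunP => F; apply/ffunP => t.
  rewrite !ffunE; have [c cE] := (wX a).2 F t.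
  have := congr1 (fun u : CPambient n k d => (u F t : {mpoly k[n]})@_a) E.
  rewrite /= sum_ffunE sum_ffunE raddf_sum (bigD1_seq a) //= big1 => [|b ne].
    rewrite !ffunE mcoeff0 addr0 cE mcoeffCM mcoeffX eqxx mulr1 => ->.
    by rewrite mpolyC0 mul0r.
  by have [c' ->] := (wX b).2 F t; rewrite mcoeffCM mcoeffX (negbTE ne) mulr0.
Qed.

(** * Freeness *)

Lemma has_homog_basisI (I : finType) (C : gmodule n k) (b : I -> gm_ambient C)
    (e : I -> 'X_{1..n}) :
  (forall i, gm_homog (e i) (b i)) ->
  (forall u, gm_mem u -> exists p : I -> {mpoly k[n]}, u = \sum_i p i *: b i) ->
  (forall p : I -> {mpoly k[n]}, \sum_i p i *: b i = 0 -> forall i, p i = 0) ->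
  has_homog_basis C.
Proof.
move=> bh bs bi; exists #|I|, (fun i => b (enum_val i)), (fun i => e (enum_val i)).
split=> [i|u /bs[p ->]|p E i]; first exact: bh.
  exists (fun i => p (enum_val i)).
  exact: (big_enum_val (fun i => p i *: b i)).
rewrite -(enum_valK i); apply: (bi (fun x => p (enum_rank x))).
apply: etrans E; rewrite (big_enum_val (fun x => p (enum_rank x) *: b x)).
by apply: eq_bigr => j _; rewrite enum_valK.
Qed.

Definition summand_basis d F r (b : 'I_r -> {ffun d.-tuple {set 'I_n} -> k}) : Prop :=
  [/\ forall i, is_cycle M F (b i),
      forall u, in_summand M F u -> exists p : 'I_r -> {mpoly k[n]},
        forall t, u t = \sum_i p i * ((b i t)%:MP * 'X_[mlabel M F])
    & forall p : 'I_r -> {mpoly k[n]},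
        (forall t, \sum_i p i * ((b i t)%:MP * 'X_[mlabel M F]) = 0) ->
        forall i, p i = 0].

Lemma exists_summand_basis d F :
  exists (r : nat) (b : 'I_r -> {ffun d.-tuple {set 'I_n} -> k}), summand_basis F b.
Proof.
have [r [b [cb bs bi]]] := cycle_basis k M d F; exists r, b; split=> //.
  move=> u [q [z [f [cz pf uE]]]].
  have /fin_all_exists[c cE] (i : 'I_q) := bs _ (cz i).
  have /fin_all_exists[g gE] (i : 'I_q) := pf i.
  exists (fun i => \sum_l (c l i)%:MP * g l) => t; rewrite uE.
  under [RHS]eq_bigr => i _ do rewrite mulr_suml.
  rewrite [RHS]exchange_big /=; apply: eq_bigr => l _.
  rewrite cE raddf_sum mulr_suml; apply: eq_bigr => i _ /=.
  by rewrite mpolyCM gE -!mulrA; congr (_ * _); rewrite mulrCA.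
move=> p p0 i; apply/mpolyP => a; rewrite mcoeff0.
apply: (bi (fun i => (p i)@_a)) => t.
(* The coefficient at [mlabel M F + a] turns the polynomial relation into a relation over [k]
   between the cycles [b]. *)
have /(congr1 (mcoeff (mlabel M F + a)%MM)) := p0 t.
rewrite mcoeff0 raddf_sum => E; apply: etrans E; apply: eq_bigr => j _ /=.
by rewrite mulrA mcoeffMX mulrC -mcoeffCM mulrC.
Qed.

Lemma CP_free d : has_homog_basis (CP k M d).
Proof.
(* Flats outside degree [d] get an empty basis, so the disjoint union [J] below only involves flats
   of degree [d]. *)
have /fin_all_exists[rb rbP] (F : {set 'I_n}) :
    exists rb : {r : nat & 'I_r -> {ffun d.-tuple {set 'I_n} -> k}},
    if in_degree M d F then summand_basis F (projT2 rb) else projT1 rb = 0%N.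
  have [_|_] := boolP (in_degree M d F); last by exists (existT _ 0%N (fun=> 0)).
  by have [r [b bP]] := exists_summand_basis d F; exists (existT _ r b).
pose r F := projT1 (rb F); pose b F : 'I_(r F) -> _ := projT2 (rb F).
have dF F (i : 'I_(r F)) : in_degree M d F.
  apply: contraT => /negbTE nF; have := rbP F; rewrite nF -/(r F) => r0.
  by case: i; rewrite r0.
have bP F (i : 'I_(r F)) : summand_basis F (b F) by have := rbP F; rewrite (dF F i).
pose J : finType := {F : {set 'I_n} & 'I_(r F)}.
pose tg F (i : 'I_(r F)) : J := existT _ F i.
pose B (j : J) : CPambient n k d :=
  monomial_part (mexp (tag j)) (fun F => if F == tag j then b _ (tagged j) else 0).
have sumB (p : J -> {mpoly k[n]}) F t : (\sum_j p j *: B j) F t =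
    \sum_i p (tg F i) * ((b F i t)%:MP * 'X_[mexp F]).
  rewrite sum_ffunE sum_ffunE.
  rewrite (eq_bigr (fun j : J => p j * (B j F t : {mpoly k[n]}))); last first.
    by move=> j _; rewrite CP_scaleE.
  transitivity (\sum_G \sum_(i < r G) p (tg G i) * (B (tg G i) F t : {mpoly k[n]})).
    by rewrite sig_big_dep; apply: eq_bigr => -[G i] _.
  rewrite (bigD1 F) //= [X in _ + X]big1 ?addr0 => [|G nG].
    by apply: eq_bigr => i _; rewrite monomial_partE /= eqxx.
  apply: big1 => i _; rewrite monomial_partE /= eq_sym (negbTE nG) ffunE.
  by rewrite mpolyC0 mul0r mulr0.
apply: (@has_homog_basisI J (CP k M d) B (fun j => mexp (tag j))) => /=.
- move=> [F i] /=; apply: strand_homog; split=> G /=.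
    by case: eqP => [->|_]; [case: (bP F i) | apply: is_cycle0].
  by case: (eqVneq G F) => [-> _|_]; rewrite ?eqxx // (dF F i) lepm_refl.
- move=> u mu.
  have /fin_all_exists[p pE] (F : {set 'I_n}) : exists p : 'I_(r F) -> {mpoly k[n]},
      forall t, u F t = \sum_i p i * ((b F i t)%:MP * 'X_[mexp F]).
    have := mu F; have := rbP F; case: ifP => [dgF|_].
      rewrite -(mlabel_degree dgF) => -[_ h _] /h[p pE]; by exists p.
    move=> r0 u0; exists (fun=> 0) => t; rewrite u0 ffunE big1 // => i _.
    by rewrite mul0r.
  exists (fun j : J => p (tag j) (tagged j)).
  by apply/ffunP => F; apply/ffunP => t; rewrite sumB pE.
- move=> p E [F i]; have [_ _ h] := bP F i.
  apply: (h (fun i => p (tg F i))) => t.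
  rewrite (mlabel_degree (dF F i)) -sumB E.
  by rewrite !ffunE.
Qed.

(** * The augmentation and its image *)

Lemma CPaug_lin p (u v : CPambient n k 0) :
  CPaug M (p *: u + v) = p * CPaug M u + CPaug M v.
Proof.
rewrite /CPaug mulr_sumr -big_split; apply: eq_bigr => H _ /=.
by rewrite CP_addE CP_scaleE.
Qed.

Lemma CPaugE (u : CPambient n k 0) : CPmem M u -> CPaug M u = \sum_H u H [tuple].
Proof.
move=> mu; rewrite /CPaug [RHS](bigID (in_degree M 0)) /= [X in _ = _ + X]big1 ?addr0 //.
by move=> H /(CPmem_out mu)->; rewrite ffunE.
Qed.

Lemma matroid_ideal_sum (I : finType) (f : I -> {mpoly k[n]}) :
  (forall i, matroid_ideal M (f i)) -> matroid_ideal M (\sum_i f i).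
Proof.
move=> /fin_all_exists[c cE]; exists (fun F => \sum_i c i F).
under [RHS]eq_bigr => F _ do rewrite mulr_suml.
by rewrite exchange_big; apply: eq_bigr => i _; rewrite {1}cE.
Qed.

(** Every proper flat lies in a hyperplane, whose monomial divides that of the flat; choosing one
    hyperplane [h F] for each [F] moves all coefficients to the atoms. *)
Lemma CP_image (f : {mpoly k[n]}) :
  matroid_ideal M f <-> exists u : CPambient n k 0, CPmem M u /\ CPaug M u = f.
Proof.
split=> [[c ->]|[u [mu <-]]]; last first.
  rewrite CPaugE //; apply: matroid_ideal_sum => H.
  have := mu H; case: ifP => [dH [r [z [g [_ pg uE]]]]|_ ->]; last first.
    by exists (fun=> 0); rewrite ffunE big1 // => F _; rewrite mul0r.
  rewrite uE; apply: matroid_ideal_sum => i; have [q ->] := pg i.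
  exists (fun F => if F == H then (z i [tuple])%:MP * q else 0).
  have [fH _] := in_degreeP _ _ _ dH.
  rewrite (bigD1 H) ?fH ?(in_degree_neqT dH) //= (eqxx H) big1 ?addr0 => [|F /andP[_ /negbTE->]].
    by rewrite (mlabel_degree dH) mulrA.
  by rewrite mul0r.
have /fin_all_exists[h hP] (F : {set 'I_n}) : exists H,
    flat M F && (F != setT) -> in_degree M 0 H /\ F \subset H.
  have [/andP[fF nF]|_] := boolP (flat M F && (F != setT)); last by exists F.
  have /subsetPn[x _ xF] : ~~ (setT \subset F) by rewrite subTset.
  have [H [hH FH _]] := exists_hyp fF (flatT M) (subsetT F) (in_setT x) xF.
  by exists H; rewrite in_degree0.
pose w H := \sum_(F | flat M F && (F != setT) && (h F == H)) c F * 'X_[mexp F].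
pose u : CPambient n k 0 := [ffun H => [ffun t => w H]].
have w0 H : ~~ in_degree M 0 H -> w H = 0.
  move=> nH; rewrite /w big_pred0 // => F; apply: contraNF nH => /andP[/hP[dF _] /eqP <-].
  exact: dF.
exists u; split; last first.
  rewrite [RHS](partition_big h (in_degree M 0)) => [|F /hP[]//].
  by apply: eq_bigr => H _; rewrite !ffunE.
move=> H; case: ifP => [dH|/negbT nH]; last first.
  by apply/ffunP => t; rewrite !ffunE w0.
(* One elementary tensor suffices: the cycle is the constant 1 on the empty tuple. *)
apply: (@in_summandI _ _ _ unit _ _ _ (fun=> [ffun=> 1]) (fun=> w H)) => [_|_|t].
- by split=> // t _; rewrite (tuple0 t).
- rewrite (mlabel_degree dH).
  exists (\sum_(F | flat M F && (F != setT) && (h F == H)) c F * 'X_[mexp F - mexp H]).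
  rewrite mulr_suml; apply: eq_bigr => F /andP[/hP[_ FH] /eqP E].
  by rewrite -mulrA -mpolyXD submK // mexpS // -E.
- by rewrite (big_pred1 tt) => [|[]//]; rewrite !ffunE mpolyC1 mul1r.
Qed.

(** * Minimality *)

Lemma in_irrelevant_sum (I : finType) d (v : I -> CPambient n k d) :
  (forall i, @in_irrelevant n k (CP k M d) (v i)) ->
  @in_irrelevant n k (CP k M d) (\sum_i v i).
Proof.
move=> /fin_all_exists[w wP]; exists (fun i => \sum_j w j i); split=> [i|].
  by apply: CPmem_sum => j; have [h _] := wP j; apply: h.
under [RHS]eq_bigr => i _ do rewrite scaler_sumr.
by rewrite exchange_big; apply: eq_bigr => j _; case: (wP j).
Qed.

(* A nonzero component at F' of the image comes from some F strictly contained
   in F', and then m_F is divisible by m_F' x_i for every i in F' \ F. *)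
Lemma strand_diff_irrelevant d a
    (z : {set 'I_n} -> {ffun d.+1.-tuple {set 'I_n} -> k}) :
  strand M a z -> @in_irrelevant n k (CP k M d) (monomial_part a (strand_diff z)).
Proof.
move=> sz; have [cy yP] := strand_diff_strand sz; set y := strand_diff z in cy yP *.
(* A variable that can be divided out of the component at [F]; each [w i] collects the components
   assigned to the variable [i]. *)
pose i0 F := [pick i | (mexp F + U_(i) <= a)%MM].
pose w i := monomial_part (a - U_(i))%MM (fun F => if i0 F == Some i then y F else 0).
exists w; split=> [i|].
  apply: strand_mem; split=> F.
    by case: ifP => _; [apply: cy | apply: is_cycle0].
  case: ifP => [|_]; last by rewrite eqxx.
  rewrite /i0; case: pickP => // j le /eqP[<-] /yP/andP[-> _] /=.
  apply/mnm_lepP => l; have /mnm_lepP/(_ l) := le.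
  by rewrite mnmDE mnmBE; lia.
apply/ffunP => F; apply/ffunP => t; rewrite sum_ffunE sum_ffunE monomial_partE.
under eq_bigr => i _ do rewrite CP_scaleE monomial_partE.
have [y0|ny] := eqVneq (y F) 0.
  rewrite y0 ffunE mpolyC0 mul0r big1 // => i _.
  by case: ifP => _; rewrite ?y0 ffunE mpolyC0 mul0r mulr0.
have [F' [dF /properP[F'F [i iF iF']] le]] := strand_diff_supp sz ny.
rewrite /i0; case: pickP => [j lej|/(_ i)/negP[]]; last first.
  apply/mnm_lepP => l; rewrite mnmDE mnm1E mnmE.
  have /mnm_lepP/(_ l) := le; rewrite mnmE.
  have [<-|_] := eqVneq i l; first by rewrite iF iF'.
  rewrite addn0; apply: leq_trans; case: (boolP (l \in F')) => [lF|_].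
    by rewrite (subsetP F'F).
  exact: leq_b1.
rewrite (bigD1 j) //= eqxx big1 ?addr0 => [|l nl].
  rewrite mulrCA -mpolyXD addmC submK //.
  by apply: lepm_trans lej; apply: lem_addl.
rewrite (_ : (Some j == Some l) = false); first by rewrite ffunE mpolyC0 mul0r mulr0.
by apply: contraNF nl => /eqP[->].
Qed.

End Resolution.

Theorem theorem3p11 (n : nat) (k : fieldType) (M : matroid n) :
  @minimal_graded_free_resolution n k
    (CP k M) (@CPdiff n k M) (@CPaug n k M) (@matroid_ideal n k M).
Proof.
split=> /=.
- exact: CP_graded.
- exact: CP_free.
- by move=> d u; apply: CPdiff_mem.
- by move=> d p u v _ _; apply: CPdiff_lin.
- move=> d a u /CPhomogP[z sz ->]; rewrite CPdiff_monomial_part //.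
  exact/strand_homog/strand_diff_strand.
- by move=> p u v _ _; apply: CPaug_lin.
- move=> a u /CPhomogP[z sz ->]; exists (\sum_(H | in_degree M 0 H) z H [tuple]).
  rewrite /CPaug raddf_sum mulr_suml; apply: eq_bigr => H _.
  by rewrite monomial_partE.
- move=> d u mu; apply/ffunP => F; apply/ffunP => s.
  rewrite CPdiffE; last exact: CPdiff_mem.
  under eq_bigr => F' _ do rewrite CPdiffE //.
  rewrite exchange_big big1 => [|F' _]; first by rewrite !ffunE.
  exact: (CPmem_first_face F' (cons_tuple F s) mu).
- move=> u mu; rewrite CPaugE; last exact: CPdiff_mem.
  under eq_bigr => F' _ do rewrite CPdiffE //.
  rewrite exchange_big big1 // => F' _; exact: (CPmem_first_face F' [tuple] mu).
- move=> d u mu u0; apply: CP_exact => // a c.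
  (* Lists of another length carry no coefficient; for [c] of length [d.+1] the sum is a coefficient
     of [CPdiff M u], with the head of [c] as target flat. *)
  have [/eqP sc|sc] := boolP (size c == d.+1); last first.
    by rewrite big1 // => F _; rewrite seqfun_size.
  case: c sc => // F c [/eqP sc]; pose t := cons_tuple F (Tuple sc).
  under eq_bigr => F' _ do rewrite (seqfunE _ t) ffunE.
  rewrite -[LHS](raddf_sum (mcoeff a)) -(CPdiffE F (Tuple sc) mu) u0 !ffunE; exact: mcoeff0.
- move=> u mu u0; apply: CP_exact => // a c.
  case: c => [|F c]; last by rewrite big1 // => H _; rewrite seqfun_size.
  under eq_bigr => F' _ do rewrite (seqfunE _ [tuple]) ffunE.
  rewrite -[LHS](raddf_sum (mcoeff a)) -(CPaugE mu) u0; exact: mcoeff0.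
- exact: CP_image.
- move=> d u mu; have [b uE] := monomial_decomp u; rewrite uE CPdiff_sum.
  apply: in_irrelevant_sum => a; have sz := (CPmemP M u).1 mu a.
  by rewrite CPdiff_monomial_part //; apply: strand_diff_irrelevant.
Qed.
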